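(* Let $\mathcal{L}$ be a completely distributive commutative subspace lattice or a subspace lattice with two atoms on a complex separable Hilbert space $\mathcal{H}$. Then the multiplier algebra $\mathcal{M}(\mathrm{Alg}\,\mathcal{L}\cap\mathcal{K}(\mathcal{H}))$ and $\mathrm{Alg}\,\mathcal{L}$ are isomorphic algebras.
   Context: A subspace lattice on $\mathcal{H}$ is a collection $\mathcal{L}$ of closed subspaces of $\mathcal{H}$ containing $(0)$ and $\mathcal{H}$ and such that for every family $\{S_r\}$ in $\mathcal{L}$ both $\bigcap S_r$ and $\bigvee S_r$ (closed linear span) belong to $\mathcal{L}$. $\mathrm{Alg}\,\mathcal{L}$ is the algebra of all bounded operators on $\mathcal{H}$ leaving every subspace in $\mathcal{L}$ invariant, and $\mathcal{K}(\mathcal{H})$ is the set of compact operators on $\mathcal{H}$. $\mathcal{L}$ is a completely distributive commutative subspace lattice if the orthogonal projections onto the members of $\mathcal{L}$ commute pairwise and $\mathcal{L}$ is completely distributive as a complete lattice ($\bigwedge_{i}\bigvee_{j\in J_i}x_{i,j}=\bigvee_{f\in\prod_i J_i}\bigwedge_i x_{i,f(i)}$ and dually, for arbitrary families). $\mathcal{L}$ is a subspace lattice with two atoms if $\mathcal{L}=\{0,M,N,\mathcal{H}\}$ with $M\wedge N=M\cap N=\{0\}$ and $M\vee N=\mathcal{H}$. A multiplier on an algebra $\mathcal{A}$ is a pair $(L,R)$ of linear maps $L,R:\mathcal{A}\to\mathcal{A}$ such that $L(ab)=L(a)b$, $R(ab)=aR(b)$ and $aL(b)=R(a)b$ for all $a,b\in\mathcal{A}$.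 The multiplier algebra $\mathcal{M}(\mathcal{A})$ is the unital algebra of all multipliers on $\mathcal{A}$ (with componentwise linear operations and product $(L_1,R_1)(L_2,R_2)=(L_1L_2,R_2R_1)$). *)

(* Defs.v *)
From HB Require Import structures.
From mathcomp Require Import all_boot all_order all_algebra.
From mathcomp Require Import complex.
From mathcomp Require Import all_classical all_reals all_analysis.

Set Implicit Arguments.
Unset Strict Implicit.
Unset Printing Implicit Defensive.

Import Order.TTheory GRing.Theory Num.Theory.
Import numFieldNormedType.Exports.

Local Open Scope classical_set_scope.
Local Open Scope ring_scope.

HB.mixin Record Lmodule_isNonUnitalAlgebra (K : pzRingType) A
    of GRing.Lmodule K A := {
  amul : A -> A -> A;
  amulA : associative amul;
  amulDl : left_distributive amul +%R;
  amulDr : right_distributive amul +%R;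
  amulZl : forall (k : K) (a b : A), amul (k *: a) b = k *: amul a b;
  amulZr : forall (k : K) (a b : A), amul a (k *: b) = k *: amul a b
}.

#[short(type="nonUnitalAlgType")]
HB.structure Definition NonUnitalAlgebra (K : pzRingType) :=
  {A of Lmodule_isNonUnitalAlgebra K A & GRing.Lmodule K A}.

(* Associative unital algebras; unlike for GRing.Algebra, 1 = 0 is allowed: the
   zero algebra occurs below when the Hilbert space is 0. *)
HB.mixin Record NonUnitalAlgebra_hasUnit (K : pzRingType) A
    of NonUnitalAlgebra K A := {
  aone : A;
  amul1l : left_id aone (@amul K A);
  amul1r : right_id aone (@amul K A)
}.

#[short(type="unitalAlgType")]
HB.structure Definition UnitalAlgebra (K : pzRingType) :=
  {A of NonUnitalAlgebra_hasUnit K A & NonUnitalAlgebra K A}.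

Definition alg_isomorphic (K : pzRingType) (A B : unitalAlgType K) : Prop :=
  exists f : A -> B,
    [/\ linear f,
        (forall a b, f (amul a b) = amul (f a) (f b)),
        f aone = aone
      & bijective f].

Section MultiplierAlgebra.
Context {K : comPzRingType}.
Variable A : nonUnitalAlgType K.
Local Notation "a ** b" := (@amul K A a b) (at level 40).

Definition is_multiplier (p : (A -> A) * (A -> A)) : Prop :=
  let: (L, R) := p in
  [/\ linear L, linear R,
      (forall a b, L (a ** b) = L a ** b),
      (forall a b, R (a ** b) = a ** R b)
    & (forall a b, a ** L b = R a ** b)].

Definition multiplier_pred : {pred (A -> A) * (A -> A)} :=
  [pred p | `[< is_multiplier p >]].

Record multiplier := Multiplier {
  multiplier_val : (A -> A) * (A -> A);
  _ : multiplier_pred multiplier_val }.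

HB.instance Definition _ := [isSub for multiplier_val].
HB.instance Definition _ := [Choice of multiplier by <:].

Lemma multiplier_submod_closed : submod_closed multiplier_pred.
Proof.
have amul0l b : 0 ** b = 0 by rewrite -[X in X ** _](scale0r 0) amulZl scale0r.
have amul0r b : b ** 0 = 0 by rewrite -[X in _ ** X](scale0r 0) amulZr scale0r.
split.
  apply/asboolP; split => /=.
  - by move=> k x y; rewrite /GRing.zero/= scaler0 addr0.
  - by move=> k x y; rewrite /GRing.zero/= scaler0 addr0.
  - by move=> a b; rewrite /GRing.zero/= amul0l.
  - by move=> a b; rewrite /GRing.zero/= amul0r.
  - by move=> a b; rewrite /GRing.zero/= amul0l amul0r.
move=> k [L R] [L' R'] /asboolP[lL lR LM RM LR] /asboolP[lL' lR' LM' RM' LR'].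
have E (f g : A -> A) x : (k *: f + g) x = k *: f x + g x by [].
apply/asboolP; split => /=.
- move=> c x y; rewrite !E lL lL' !scalerDr !scalerA mulrC.
  by rewrite -!addrA; congr (_ + _); rewrite addrCA.
- move=> c x y; rewrite !E lR lR' !scalerDr !scalerA mulrC.
  by rewrite -!addrA; congr (_ + _); rewrite addrCA.
- by move=> a b; rewrite !E LM LM' amulDl amulZl.
- by move=> a b; rewrite !E RM RM' amulDr amulZr.
- by move=> a b; rewrite !E amulDr amulZr LR LR' amulDl amulZl.
Qed.

HB.instance Definition _ :=
  GRing.isSubmodClosed.Build _ _ multiplier_pred multiplier_submod_closed.
HB.instance Definition _ := [SubChoice_isSubLmodule of multiplier by <:].

Lemma multiplier_one_subproof : multiplier_pred (id, id).
Proof. by apply/asboolP; split. Qed.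

Definition multiplier_one : multiplier := Multiplier multiplier_one_subproof.

Lemma multiplier_mul_subproof (u v : multiplier) :
  multiplier_pred ((val u).1 \o (val v).1, (val v).2 \o (val u).2).
Proof.
case: u => -[L R] /= /asboolP[lL lR LM RM LR].
case: v => -[L' R'] /= /asboolP[lL' lR' LM' RM' LR'].
apply/asboolP; split => /=.
- by move=> k x y /=; rewrite lL' lL.
- by move=> k x y /=; rewrite lR lR'.
- by move=> a b /=; rewrite LM' LM.
- by move=> a b /=; rewrite RM RM'.
- by move=> a b /=; rewrite LR LR'.
Qed.

Definition multiplier_mul (u v : multiplier) : multiplier :=
  Multiplier (multiplier_mul_subproof u v).

Let mmulA : associative multiplier_mul.
Proof. by move=> u v w; apply/val_inj. Qed.
Let mmul1l : left_id multiplier_one multiplier_mul.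
Proof. by move=> u; apply/val_inj => /=; case: (val u). Qed.
Let mmul1r : right_id multiplier_one multiplier_mul.
Proof. by move=> u; apply/val_inj => /=; case: (val u). Qed.
Let mmulDl : left_distributive multiplier_mul +%R.
Proof.
move=> u v w; apply/val_inj => /=; rewrite /multiplier_mul /=.
case: w => -[L R] /= w; have /asboolP[_ lR _ _ _] := w.
congr (_, _); apply/funext => x //=.
by have := lR 1 ((val u).2 x) ((val v).2 x); rewrite !scale1r.
Qed.
Let mmulDr : right_distributive multiplier_mul +%R.
Proof.
move=> w u v; apply/val_inj => /=.
case: w => -[L R] /= w; have /asboolP[lL _ _ _ _] := w.
congr (_, _); apply/funext => x //=.
by have := lL 1 ((val u).1 x) ((val v).1 x); rewrite !scale1r.
Qed.

Let mmulZl (k : K) (u v : multiplier) :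
  multiplier_mul (k *: u) v = k *: multiplier_mul u v.
Proof.
apply/val_inj => /=.
case: v => -[L R] /= v; have /asboolP[_ lR _ _ _] := v.
have R0 : R 0 = 0 by have := lR (-1) 0 0; rewrite scaleN1r !addNr scaleN1r addNr.
congr (_, _); apply/funext => x //=.
by have := lR k ((val u).2 x) 0; rewrite R0 !addr0.
Qed.
Let mmulZr (k : K) (u v : multiplier) :
  multiplier_mul u (k *: v) = k *: multiplier_mul u v.
Proof.
apply/val_inj => /=.
case: u => -[L R] /= u; have /asboolP[lL _ _ _ _] := u.
have L0 : L 0 = 0 by have := lL (-1) 0 0; rewrite scaleN1r !addNr scaleN1r addNr.
congr (_, _); apply/funext => x //=.
by have := lL k ((val v).1 x) 0; rewrite L0 !addr0.
Qed.

HB.instance Definition _ := Lmodule_isNonUnitalAlgebra.Build K multiplier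
  mmulA mmulDl mmulDr mmulZl mmulZr.
HB.instance Definition _ := NonUnitalAlgebra_hasUnit.Build K multiplier
  mmul1l mmul1r.

End MultiplierAlgebra.

(* Complex Hilbert spaces; {dot _ for _} is linear in its first argument and
   conjugate-linear in its second. *)
HB.mixin Record NormedModule_hasInner (R : realType) (H : Type)
    of NormedModule R[i] H := {
  inner : {dot H for (@Num.conj R[i])};
  inner_norm : forall x : H, inner x x = `|x| ^+ 2
}.

#[short(type="hilbertType")]
HB.structure Definition Hilbert (R : realType) :=
  {H of NormedModule_hasInner R H & CompleteNormedModule R[i] H}.

Section SubspaceLattices.
Context {R : realType} {H : hilbertType R}.
Implicit Types (A S : set H) (F : set (set H)).

Definition separable : Prop := exists2 D : set H, countable D & dense D.

Definition closed_subspace S : Prop :=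
  [/\ S 0, (forall (a : R[i]) x y, S x -> S y -> S (a *: x + y)) & closed S].

Definition linear_span A : set H :=
  [set v | exists n (c : 'I_n -> R[i]) (x : 'I_n -> H),
     (forall i, A (x i)) /\ v = \sum_(i < n) c i *: x i].

Definition closed_span A : set H := closure (linear_span A).

(* A family of members enters only through its set F of values. *)
Record subspace_lattice := SubspaceLattice {
  sl_mem :> set H -> Prop;
  sl_closed : forall S, sl_mem S -> closed_subspace S;
  sl_0 : sl_mem [set 0];
  sl_T : sl_mem setT;
  sl_meet : forall F, F `<=` sl_mem -> sl_mem (\bigcap_(S in F) S);
  sl_join : forall F, F `<=` sl_mem -> sl_mem (closed_span (\bigcup_(S in F) S))
}.

Definition orthogonal_projection S (P : H -> H) : Prop :=
  forall x, S (P x) /\ (forall y, S y -> inner (x - P x) y = 0).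

Definition commutative_lattice (L : subspace_lattice) : Prop :=
  forall S T P Q, L S -> L T ->
    orthogonal_projection S P -> orthogonal_projection T Q -> P \o Q = Q \o P.

(* In a subspace lattice the complete-lattice meet of a family is its
   intersection and the join is its closed linear span. *)
Definition completely_distributive (L : subspace_lattice) : Prop :=
  forall (I : Type) (J : I -> Type) (x : forall i, J i -> set H),
    (forall i j, L (x i j)) ->
    \bigcap_i closed_span (\bigcup_j x i j) =
      closed_span (\bigcup_(f : forall i, J i) \bigcap_i x i (f i))
    /\
    closed_span (\bigcup_i \bigcap_j x i j) =
      \bigcap_(f : forall i, J i) closed_span (\bigcup_i x i (f i)).

(* M and N are not required to be nonzero: M = 0 forces N = H and then L is the
   trivial lattice {0, H}. *)
Definition two_atoms (L : subspace_lattice) : Prop :=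
  exists M N : set H,
    [/\ sl_mem L = [set [set 0]; M; N; setT],
        M `&` N = [set 0]
      & closed_span (M `|` N) = setT].

End SubspaceLattices.

Arguments separable {R} H.
Arguments subspace_lattice {R} H.

Section Operators.
Context {R : realType} (H : hilbertType R).

Definition bounded_operator (T : H -> H) : Prop :=
  linear T /\ exists M : R, forall x, `|T x| <= (M%:C)%C * `|x|.

Definition compact_operator (T : H -> H) : Prop :=
  linear T /\ precompact (T @` [set x | `|x| <= 1]).

Lemma bounded_continuous T : bounded_operator T -> continuous T.
Proof.
move=> [lT [M MT]].
pose mT := GRing.isLinear.Build R[i] H H *:%R T lT.
pose LT : {linear H -> H} := HB.pack T mT.
apply: (@bounded_linear_continuous _ _ _ LT).
apply/ex_bound; exists (`|M|%:C)%C; apply/nbhs_norm0P; exists 1 => //= x /= x1.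
apply: (le_trans (MT x)).
have : (M%:C <= `|M|%:C)%C by rewrite lecR ler_norm.
move=> /(ler_wpM2r (normr_ge0 x))/le_trans; apply.
rewrite -[leRHS]mulr1 ler_wpM2l ?(ltW x1)//.
by rewrite ler0c.
Qed.

Lemma bounded_operator0 : bounded_operator 0.
Proof.
split; first by move=> a x y; rewrite /GRing.zero/= scaler0 addr0.
by exists 0 => x; rewrite /GRing.zero/= normr0 mul0r.
Qed.

Lemma bounded_operator_lin (a : R[i]) (S T : H -> H) :
  bounded_operator S -> bounded_operator T -> bounded_operator (a *: S + T).
Proof.
have E x : (a *: S + T) x = a *: S x + T x by [].
move=> [lS [M MS]] [lT [N NT]]; split.
  move=> c x y; rewrite !E lS lT !scalerDr !scalerA mulrC.
  by rewrite -!addrA; congr (_ + _); rewrite addrCA.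
have [r ar] : exists r : R, `|a| = (r%:C)%C.
  by exists (complex.Re `|a|); rewrite RRe_real// normr_real.
exists (r * M + N) => x; rewrite E (le_trans (ler_normD _ _))//.
rewrite rmorphD rmorphM/= mulrDl lerD// normrZ ar -mulrA ler_wpM2l//.
by rewrite -ar.
Qed.

Lemma bounded_operator_comp (S T : H -> H) :
  bounded_operator S -> bounded_operator T -> bounded_operator (S \o T).
Proof.
move=> [lS [M MS]] [lT [N NT]]; split; first by move=> c x y /=; rewrite lT lS.
exists (`|M| * N) => x /=; apply: (le_trans (MS _)).
have : (M%:C <= `|M|%:C)%C by rewrite lecR ler_norm.
move=> /(ler_wpM2r (normr_ge0 (T x)))/le_trans; apply.
by rewrite rmorphM/= -mulrA ler_wpM2l// ler0c.
Qed.

Lemma compact_operator0 : compact_operator 0.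
Proof.
split; first by move=> a x y; rewrite /GRing.zero/= scaler0 addr0.
apply: (@precompact_subset _ _ [set 0]); first by move=> _ [x _ <-].
by apply: compact_precompact; [exact: norm_hausdorff|exact: compact_set1].
Qed.

Lemma compact_operator_lin (a : R[i]) (S T : H -> H) :
  compact_operator S -> compact_operator T -> compact_operator (a *: S + T).
Proof.
have E x : (a *: S + T) x = a *: S x + T x by [].
move=> [lS cS] [lT cT]; split.
  move=> c x y; rewrite !E lS lT !scalerDr !scalerA mulrC.
  by rewrite -!addrA; congr (_ + _); rewrite addrCA.
move: cS cT; rewrite !precompactE; set B := [set x | _] => cS cT.
pose g (p : H * H) := a *: p.1 + p.2.
rewrite -precompactE.
apply: (@precompact_subset _ _ (g @` (closure (S @` B) `*` closure (T @` B)))).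
  move=> _ [x Bx <-]; exists (S x, T x) => //.
  by split; apply: subset_closure; exists x.
apply: compact_precompact; first exact: norm_hausdorff.
apply: continuous_compact; last exact: compact_setX.
apply: continuous_subspaceT => p; rewrite /g.
by apply: cvgD; [apply: cvgZr; exact: cvg_fst|exact: cvg_snd].
Qed.

Lemma compact_operator_comp (S T : H -> H) :
  bounded_operator S -> compact_operator T -> compact_operator (S \o T).
Proof.
move=> bS [lT cT]; have cS := bounded_continuous bS; have [lS _] := bS.
split; first by move=> c x y /=; rewrite lT lS.
move: cT; rewrite !precompactE; set B := [set x | _] => cT.
rewrite -precompactE.
apply: (@precompact_subset _ _ (S @` closure (T @` B))).
  move=> _ [x Bx <-]; exists (T x) => //.
  by apply: subset_closure; exists x.
apply: compact_precompact; first exact: norm_hausdorff.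
by apply: continuous_compact => //; exact: continuous_subspaceT.
Qed.

End Operators.

Section LatticeAlgebras.
Context {R : realType} {H : hilbertType R}.
Variable L : subspace_lattice H.

Definition in_Alg (T : H -> H) : Prop :=
  bounded_operator T /\ forall S, L S -> T @` S `<=` S.

Definition Alg_pred : {pred H -> H} := [pred T | `[< in_Alg T >]].

Record Alg := MkAlg { Alg_val :> H -> H; _ : Alg_pred Alg_val }.

HB.instance Definition _ := [isSub for Alg_val].
HB.instance Definition _ := [Choice of Alg by <:].

Lemma Alg_submod_closed : submod_closed Alg_pred.
Proof.
split.
  apply/asboolP; split; first exact: bounded_operator0.
  by move=> S /sl_closed[S0 _ _] _ [x _ <-].
move=> a S T /asboolP[bS AS] /asboolP[bT AT]; apply/asboolP; split.
  exact: bounded_operator_lin.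
move=> M LM _ [x Mx <-]; have [_ lM _] := sl_closed LM.
by apply: lM; [apply: AS|apply: AT] => //; exists x.
Qed.

HB.instance Definition _ :=
  GRing.isSubmodClosed.Build _ _ Alg_pred Alg_submod_closed.
HB.instance Definition _ := [SubChoice_isSubLmodule of Alg by <:].

Lemma Alg_one_subproof : Alg_pred id.
Proof.
apply/asboolP; split; last by move=> S _ _ [x Sx <-].
by split=> //; exists 1 => x; rewrite mul1r.
Qed.

Definition Alg_one : Alg := MkAlg Alg_one_subproof.

Lemma Alg_mul_subproof (S T : Alg) : Alg_pred (S \o T).
Proof.
have /asboolP[bS AS] := valP S; have /asboolP[bT AT] := valP T.
apply/asboolP; split; first exact: bounded_operator_comp.
move=> M LM _ [x Mx <-]; apply: AS => //; exists (T x) => //.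
by apply: AT => //; exists x.
Qed.

Definition Alg_mul (S T : Alg) : Alg := MkAlg (Alg_mul_subproof S T).

Let AmulA : associative Alg_mul.
Proof. by move=> S T U; apply/val_inj. Qed.
Let Amul1l : left_id Alg_one Alg_mul.
Proof. by move=> S; apply/val_inj. Qed.
Let Amul1r : right_id Alg_one Alg_mul.
Proof. by move=> S; apply/val_inj. Qed.
Let AmulDl : left_distributive Alg_mul +%R.
Proof. by move=> S T U; apply/val_inj. Qed.
Let AmulDr : right_distributive Alg_mul +%R.
Proof.
move=> S T U; apply/val_inj/funext => x /=.
have /asboolP[[lS _] _] := valP S.
by have := lS 1 (T x) (U x); rewrite !scale1r.
Qed.
Let AmulZl (k : R[i]) S T : Alg_mul (k *: S) T = k *: Alg_mul S T.
Proof. exact/val_inj. Qed.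
Let AmulZr (k : R[i]) S T : Alg_mul S (k *: T) = k *: Alg_mul S T.
Proof.
apply/val_inj/funext => x /=.
have /asboolP[[lS _] _] := valP S.
have S0 : S 0 = 0 by have := lS (-1) 0 0; rewrite scaleN1r !addNr scaleN1r addNr.
by have := lS k (T x) 0; rewrite /= S0 !addr0.
Qed.

HB.instance Definition _ := Lmodule_isNonUnitalAlgebra.Build R[i] Alg
  AmulA AmulDl AmulDr AmulZl AmulZr.
HB.instance Definition _ := NonUnitalAlgebra_hasUnit.Build R[i] Alg
  Amul1l Amul1r.

Definition compact_Alg_pred : {pred Alg} :=
  [pred T : Alg | `[< compact_operator T >]].

Record compact_Alg :=
  MkCompactAlg { compact_Alg_val :> Alg; _ : compact_Alg_pred compact_Alg_val }.

HB.instance Definition _ := [isSub for compact_Alg_val].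
HB.instance Definition _ := [Choice of compact_Alg by <:].

Lemma compact_Alg_submod_closed : submod_closed compact_Alg_pred.
Proof.
split; first by apply/asboolP; exact: compact_operator0.
move=> a S T /asboolP cS /asboolP cT; apply/asboolP.
exact: compact_operator_lin.
Qed.

HB.instance Definition _ :=
  GRing.isSubmodClosed.Build _ _ compact_Alg_pred compact_Alg_submod_closed.
HB.instance Definition _ := [SubChoice_isSubLmodule of compact_Alg by <:].

Lemma compact_Alg_mul_subproof (S T : compact_Alg) :
  compact_Alg_pred (amul (val S) (val T)).
Proof.
have /asboolP[bS _] := valP (val S); have /asboolP cT := valP T.
by apply/asboolP; exact: compact_operator_comp.
Qed.

Definition compact_Alg_mul (S T : compact_Alg) : compact_Alg :=
  MkCompactAlg (compact_Alg_mul_subproof S T).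

Let KmulA : associative compact_Alg_mul.
Proof. by move=> S T U; apply/val_inj; exact: amulA. Qed.
Let KmulDl : left_distributive compact_Alg_mul +%R.
Proof. by move=> S T U; apply/val_inj; exact: amulDl. Qed.
Let KmulDr : right_distributive compact_Alg_mul +%R.
Proof. by move=> S T U; apply/val_inj; exact: amulDr. Qed.
Let KmulZl (k : R[i]) S T :
  compact_Alg_mul (k *: S) T = k *: compact_Alg_mul S T.
Proof. by apply/val_inj; exact: amulZl. Qed.
Let KmulZr (k : R[i]) S T :
  compact_Alg_mul S (k *: T) = k *: compact_Alg_mul S T.
Proof. by apply/val_inj; exact: amulZr. Qed.

HB.instance Definition _ := Lmodule_isNonUnitalAlgebra.Build R[i] compact_Alg
  KmulA KmulDl KmulDr KmulZl KmulZr.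

End LatticeAlgebras.

(* Main.v *)
Require Import Defs.
From mathcomp Require Import all_boot all_order all_algebra.
From mathcomp Require Import complex.
From mathcomp Require Import all_classical all_reals all_analysis.
From mathcomp Require Import ring lra.

Set Implicit Arguments.
Unset Strict Implicit.
Unset Printing Implicit Defensive.

Import Order.TTheory GRing.Theory Num.Theory.
Import numFieldNormedType.Exports.

Local Open Scope classical_set_scope.
Local Open Scope ring_scope.

(** Write A for the algebra of compact operators in Alg L.  Left and right
    multiplication by an element of Alg L is a multiplier of A, and the theorem says
    that every multiplier (l, r) comes in this way from a unique operator T.

    Such a T satisfies b (T x) = r(b) x for all b in A, which determines T x as soon as
    A separates points.  Conversely b (l(a) y) = r(b) (a y), so T is defined on all the
    ranges of elements of A, by T (a y) = l(a) y, and the question is whether these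
    ranges exhaust the space with a bound on T.  As in the factorization theorem of
    Cohen, it is enough that A has pointwise bounded approximate units
    ([approx_unit]): an a in A of norm at most C, depending on x, with
    |x - a x| <= q |x| for a fixed q < 1.  Starting from x_0 = x and
    x_(k+1) = x_k - a_k x_k one gets x = sum_k a_k x_k with geometric convergence, and
    T x = sum_k l(a_k) x_k.  This needs l to be bounded, which follows by a gliding
    hump because A is complete ([cA_uniform_bounded], [left_multiplier_bounded],
    [multiplier_operator]).  Rescaling a, the condition on A becomes a lower bound
    Re <a x, x> >= d |x|^2 with |a| <= C ([coercive_unit]), and this is what has to be
    proved for both kinds of lattices.

    Completely distributive commutative lattices.  For S in L let S_- be the join of
    the members of L that do not contain S ([lower]).  The operator u (x) v* is in A if
    u is in S and v is orthogonal to S_-.  Let P_S and F_S be the projections on S and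
    on the orthogonal complement of S_-; all of them commute.  The operator a is built
    by a greedy transport plan: there are two weights g and h, products of positive
    contractions in the commutative algebra of L, initially 1.  Treating S means
    replacing g by g - s g P_S and h by h - t h F_S, where s and t are chosen such that
    both lose the same mass at x and one of them is exhausted (s = 1 or t = 1), and
    adding to a the rank-one operator that vanishes on the orthogonal complement of
    h F_S x and maps x to s g P_S x ([greedy_step]).  Then a x = x - g x throughout, and
    a telescoping Schur test shows that a is a contraction.  Complete distributivity
    says that Q is the intersection of the S_- over the S in L not contained in Q
    ([completely_distributive_lower]).  Hence if Q is the join of the S with g P_S = 0
    and h F_S = 0 for all the other S, then g lives on the complement of Q and
    h on Q.  As <g x, x> = <h x, x>, this mass is at most half of |x|^2.  Finitely many
    S suffice up to an error, by an ultrafilter on the finite sequences of members of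
    the lattice ([distributive_coercive_unit]).

    Lattices with two atoms M and N.  Let P and Q be the projections on M and N,
    D = P - Q and S = P + Q - 1.  Then S^2 + D^2 = 1, S D = - D S, and D is injective.
    The operators P X (1 - Q) and Q X (1 - P) are in A for X of finite rank.  For a
    finite rank projection E they are combined into an operator [two_atom_op] whose
    size is that of D^2, and which has the same quadratic form as 2 (1 - S^4) at those
    vectors on which E acts as the identity.  It has to be divided by D^2, which can
    be arbitrarily small.  With b = S^4 this is done by the binomial series
    2 = sum_n (n+1)(n+2) (1 - b)^3 b^n, whose n-th term lives where D^2 is of the
    order 1/n: each term is realized at x by a finite rank operator in A, and the norm
    of the sum is controlled by an estimate that weights the n-th term with n + 2.
    Everything reduces to the moments |S^(2 n) x|^2 and their finite differences
    ([sum_fdiff2], [sum_fdiff3], [sum_fdiff4], [two_atoms_coercive_unit]). *)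

(** * The real inner product of a complex Hilbert space *)

Section RealInner.
Context {R : realType} {H : hilbertType R}.
Implicit Types (x y z u v : H) (a c : R[i]) (t r : R).

(** The real part of the inner product is a real inner product with the same norm;
    all the estimates take place in R rather than in R[i]. *)
Definition rip x y : R := complex.Re (inner x y).
Definition nsq x : R := rip x x.

Lemma innerC x y : inner x y = (inner y x)^*%C.
Proof. by rewrite hermC expr0 mul1r. Qed.

Lemma innerDl x y z : inner (x + y) z = inner x z + inner y z.
Proof. by rewrite linearDl. Qed.
Lemma innerDr x y z : inner z (x + y) = inner z x + inner z y.
Proof. by rewrite linearDr. Qed.
Lemma innerZl a x y : inner (a *: x) y = a * inner x y.
Proof. by rewrite linearZl_LR. Qed.
Lemma innerZr a x y : inner x (a *: y) = a^*%C * inner x y.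
Proof. by rewrite linearZr_LR. Qed.
Lemma inner0l x : inner 0 x = 0. Proof. by rewrite linear0l. Qed.
Lemma inner0r x : inner x 0 = 0. Proof. by rewrite linear0r. Qed.
Lemma innerNl x y : inner (- x) y = - inner x y. Proof. by rewrite linearNl. Qed.
Lemma innerNr x y : inner x (- y) = - inner x y. Proof. by rewrite linearNr. Qed.
Lemma innerBl x y z : inner (x - y) z = inner x z - inner y z.
Proof. by rewrite linearBl. Qed.
Lemma innerBr x y z : inner z (x - y) = inner z x - inner z y.
Proof. by rewrite linearBr. Qed.

Lemma ReD a c : complex.Re (a + c) = complex.Re a + complex.Re c.
Proof. by rewrite raddfD. Qed.
Lemma ReN a : complex.Re (- a) = - complex.Re a.
Proof. by rewrite raddfN. Qed.
Lemma ReZ t a : complex.Re (t%:C%C * a) = t * complex.Re a.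
Proof. by case: a => a b /=; rewrite mul0r subr0. Qed.

Lemma ripDl x y z : rip (x + y) z = rip x z + rip y z.
Proof. by rewrite /rip innerDl ReD. Qed.
Lemma ripDr x y z : rip z (x + y) = rip z x + rip z y.
Proof. by rewrite /rip innerDr ReD. Qed.
Lemma ripNl x y : rip (- x) y = - rip x y.
Proof. by rewrite /rip innerNl ReN. Qed.
Lemma ripNr x y : rip x (- y) = - rip x y.
Proof. by rewrite /rip innerNr ReN. Qed.
Lemma rip0l x : rip 0 x = 0. Proof. by rewrite /rip inner0l. Qed.
Lemma rip0r x : rip x 0 = 0. Proof. by rewrite /rip inner0r. Qed.
Lemma ripZl t x y : rip (t%:C%C *: x) y = t * rip x y.
Proof. by rewrite /rip innerZl ReZ. Qed.
Lemma ripC x y : rip x y = rip y x.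
Proof. by rewrite /rip innerC; case: (inner y x). Qed.
Lemma ripZr t x y : rip x (t%:C%C *: y) = t * rip x y.
Proof. by rewrite ripC ripZl ripC. Qed.

Definition ripE := (ripDl, ripDr, ripNl, ripNr, ripZl, ripZr, rip0l, rip0r).

Lemma inner_self x : inner x x = (nsq x)%:C%C.
Proof.
have rx : inner x x \is Num.real by rewrite inner_norm realX// normr_real.
by rewrite /nsq /rip RRe_real.
Qed.

Lemma nsq_ge0 x : 0 <= nsq x.
Proof. by rewrite -ler0c -inner_self inner_norm exprn_ge0. Qed.

Definition nr x : R := Num.sqrt (nsq x).

Lemma nr_ge0 x : 0 <= nr x. Proof. exact: sqrtr_ge0. Qed.
Lemma nr_sqr x : nr x ^+ 2 = nsq x. Proof. by rewrite sqr_sqrtr// nsq_ge0. Qed.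

Lemma normE x : `|x| = (nr x)%:C%C.
Proof.
apply/eqP; rewrite -(@eqrXn2 _ 2)// ?ler0c ?nr_ge0//.
by rewrite -inner_norm inner_self -rmorphXn/= nr_sqr.
Qed.

Lemma nr0 : nr 0 = 0. Proof. by rewrite /nr /nsq rip0l sqrtr0. Qed.
Lemma nrN x : nr (- x) = nr x.
Proof. by rewrite /nr /nsq !ripE opprK. Qed.
Lemma nrBC x y : nr (x - y) = nr (y - x). Proof. by rewrite -nrN opprB. Qed.
Lemma nr_triangle x y : nr (x + y) <= nr x + nr y.
Proof. by rewrite -lecR rmorphD/= -!normE ler_normD. Qed.
Lemma nr_eq0 x : nr x = 0 -> x = 0.
Proof. by move=> x0; apply/eqP; rewrite -normr_eq0 normE x0. Qed.
Lemma nsq0 : nsq 0 = 0. Proof. exact: rip0l. Qed.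
Lemma nsq_eq0 x : nsq x = 0 -> x = 0.
Proof. by move=> x0; apply: nr_eq0; rewrite /nr x0 sqrtr0. Qed.
Lemma nrZ t x : nr (t%:C%C *: x) = `|t| * nr x.
Proof. by rewrite /nr /nsq !ripE mulrA -expr2 sqrtrM ?sqr_ge0// sqrtr_sqr. Qed.
Lemma nsqD x y : nsq (x + y) = nsq x + 2 * rip x y + nsq y.
Proof. by rewrite /nsq !ripE (ripC y x); ring. Qed.
Lemma nsqN x : nsq (- x) = nsq x. Proof. by rewrite /nsq !ripE opprK. Qed.
Lemma nsqB x y : nsq (x - y) = nsq x - 2 * rip x y + nsq y.
Proof. by rewrite nsqD nsqN !ripE; ring. Qed.
Lemma nsqZ t x : nsq (t%:C%C *: x) = t ^+ 2 * nsq x.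
Proof. by rewrite /nsq !ripE; ring. Qed.
Lemma nr_le x (r : R) : 0 <= r -> (nr x <= r) = (nsq x <= r ^+ 2).
Proof. by move=> r0; rewrite -nr_sqr ler_pXn2r// ?nnegrE// nr_ge0. Qed.
Lemma nr_ler x y : (nr x <= nr y) = (nsq x <= nsq y).
Proof. by rewrite nr_le ?nr_ge0// nr_sqr. Qed.

Lemma rip_le x y : rip x y <= nr x * nr y.
Proof.
have [x0|x0] := eqVneq (nr x) 0; first by rewrite (nr_eq0 x0) rip0l nr0 mul0r.
have [y0|y0] := eqVneq (nr y) 0; first by rewrite (nr_eq0 y0) rip0r nr0 mulr0.
have px : 0 < nr x by rewrite lt_neqAle eq_sym x0 nr_ge0.
have py : 0 < nr y by rewrite lt_neqAle eq_sym y0 nr_ge0.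
have := nsq_ge0 ((nr y)%:C%C *: x - (nr x)%:C%C *: y).
rewrite nsqB !nsqZ !ripE -!nr_sqr => h.
have : 0 <= (nr x * nr y) * (nr x * nr y - rip x y) by nra.
by rewrite pmulr_rge0 ?mulr_gt0// subr_ge0.
Qed.

(** Reduces an identity between vectors to one between scalars, where [ring] applies. *)
Lemma rip_inj x y : (forall z, rip x z = rip y z) -> x = y.
Proof.
move=> h; apply/eqP; rewrite -subr_eq0; apply/eqP/nsq_eq0.
by rewrite /nsq ripDl ripNl h subrr.
Qed.

Lemma inner_inj x y : (forall z, inner x z = inner y z) -> x = y.
Proof. by move=> h; apply: rip_inj => z; rewrite /rip h. Qed.

(** Balls in H have radii in R[i]; only those with a real radius matter. *)
Lemma closureP (A : set H) x :
  closure A x <-> forall e : R, 0 < e -> exists2 y, A y & nr (x - y) < e.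
Proof.
split=> [clA e e0|h B].
  have /clA [y [Ay By]] : nbhs x (ball x (e%:C)%C).
    by apply: nbhsx_ballx; rewrite ltcR.
  exists y => //; move: By; rewrite -ball_normE/= /ball_/= => By.
  by rewrite -ltcR -normE.
move=> /nbhs_ballP[[e e'] /= e0 eB].
move: e0; rewrite ltcE/= => /andP[/eqP e'0 e0].
have [y Ay xy] := h _ e0; exists y; split=> //; apply: eB.
by rewrite -ball_normE/= /ball_/= normE e'0 (ltcR _ e).
Qed.

Lemma closed_lim (A : set H) x : closed A ->
  (forall e : R, 0 < e -> exists2 y, A y & nr (x - y) < e) -> A x.
Proof. by move=> cA h; rewrite (closure_id A).1//; apply/closureP. Qed.

Definition hcvg (u : nat -> H) l :=
  forall e : R, 0 < e -> exists N, forall n, (N <= n)%N -> nr (u n - l) < e.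

Lemma hcvgP (u : nat -> H) l : (u @ \oo --> l) <-> hcvg u l.
Proof.
split=> [/cvgrPdist_lt h e e0|h].
  have e0' : 0 < e%:C%C :> R[i] by rewrite ltcR.
  have [N _ hN] := h _ e0'.
  exists N => n Nn; have /= := hN n Nn.
  by rewrite normE ltcR nrBC.
apply/cvgrPdist_lt => -[e e']; rewrite ltcE/= => /andP[/eqP e'0 e0].
have [N hN] := h _ e0; exists N => // n /= Nn.
by rewrite normE e'0 (ltcR _ e) nrBC hN.
Qed.

Lemma hcauchy (u : nat -> H) :
  (forall e : R, 0 < e ->
     exists N, forall n m, (N <= n)%N -> (N <= m)%N -> nr (u n - u m) < e) ->
  exists l, hcvg u l.
Proof.
move=> h; exists (lim (u @ \oo)); apply/hcvgP.
apply/cauchy_cvgP/cauchyP => -[e e'].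
rewrite ltcE/= => /andP[/eqP e'0 e0].
have [N hN] := h _ e0; exists (u N); exists N => // n /= Nn.
by rewrite -ball_normE/= /ball_/= normE e'0 (ltcR _ e) hN.
Qed.

Lemma hcvg_closed (A : set H) (u : nat -> H) l : closed A ->
  (forall n, A (u n)) -> hcvg u l -> A l.
Proof.
move=> cA Au ul; apply: closed_lim => // e e0; have [N hN] := ul _ e0.
by exists (u N) => //; rewrite nrBC hN.
Qed.

Lemma invS_lt (e : R) : 0 < e -> exists N, forall n, (N <= n)%N -> n.+1%:R^-1 < e.
Proof.
by move=> e0; have [N _ hN] := near_infty_natSinv_lt (PosNum e0); exists N.
Qed.

Lemma expr_small (q d : R) : 0 <= q -> q < 1 -> 0 < d -> exists n, q ^+ n < d.
Proof.
move=> q0 q1 d0; have /cvgrPdist_lt /(_ d d0)[N _ hN] : q ^+ n @[n --> \oo] --> (0 : R).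
  by apply: cvg_expr; rewrite ger0_norm.
by exists N; have /= := hN N (leqnn N); rewrite sub0r normrN ger0_norm// exprn_ge0.
Qed.

(** * Orthogonal projections *)

Section Projection.
Variable S : set H.
Hypothesis cS : closed_subspace S.

Lemma subspaceD x y : S x -> S y -> S (x + y).
Proof. by case: cS => _ h _ Sx Sy; rewrite -[x]scale1r; exact: h. Qed.
Lemma subspaceZ a x : S x -> S (a *: x).
Proof. by case: cS => S0 h _ Sx; rewrite -[_ *: _]addr0; exact: h. Qed.
Lemma subspaceN x : S x -> S (- x).
Proof. by move=> Sx; rewrite -scaleN1r; exact: subspaceZ. Qed.
Lemma subspaceB x y : S x -> S y -> S (x - y).
Proof. by move=> Sx Sy; apply: subspaceD => //; exact: subspaceN. Qed.

(** If y nearly realizes the distance of x to S, then moving y along s cannot decrease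
    the distance by more than e ^ 2, so that x - y is nearly orthogonal to s. *)
Lemma nearest_point_orth x y (d e : R) : 0 <= e -> S y ->
  (forall s, S s -> d <= nsq (x - s)) -> nsq (x - y) <= d + e ^+ 2 ->
  forall s, S s -> `|rip (x - y) s| <= e * nr s.
Proof.
move=> e0 Sy hd hy s Ss.
have key t : 0 <= e ^+ 2 - 2 * t * rip (x - y) s + t ^+ 2 * nsq s.
  have := hd (y + t%:C%C *: s) (subspaceD Sy (subspaceZ _ Ss)).
  by rewrite opprD addrA nsqB nsqZ !ripE; move: hy; nra.
rewrite -(@ler_pXn2r _ 2)// ?nnegrE ?mulr_ge0 ?nr_ge0// exprMn nr_sqr real_normK ?num_real//.
have [s0|s0] := eqVneq (nsq s) 0.
  by rewrite (nsq_eq0 s0) rip0r nsq0 mulr0 expr0n.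
have ps : 0 < nsq s by rewrite lt_neqAle eq_sym s0 nsq_ge0.
have := key (rip (x - y) s / nsq s).
set p := rip _ _; set q := nsq s in s0 ps *.
move=> /(mulr_ge0 (ltW ps)).
suff -> : q * (e ^+ 2 - 2 * (p / q) * p + (p / q) ^+ 2 * q) = e ^+ 2 * q - p ^+ 2.
  by rewrite subr_ge0.
by field.
Qed.

(** Real orthogonality to a complex subspace is complex orthogonality, because the
    imaginary part of the inner product with s is the real part of that with i s. *)
Lemma orth_inner x : (forall s, S s -> rip x s = 0) -> forall s, S s -> inner x s = 0.
Proof.
move=> h s Ss; have := h s Ss; have := h _ (subspaceZ (0 +i* 1)%C Ss).
rewrite /rip innerZr; case: (inner x s) => p q /=; rewrite mul0r sub0r mulN1r opprK.
by move=> -> ->.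
Qed.

(** The projection is the limit of a minimizing sequence for the distance to S. *)
Lemma orthogonal_projection_exists : exists P, orthogonal_projection S P.
Proof.
have [S0 lS clS] := cS.
suff h x : exists p, S p /\ forall y, S y -> inner (x - p) y = 0.
  by have [P hP] := choice h; exists P.
pose E := [set nsq (x - y) | y in S].
have E0 : has_inf E.
  split; first by exists (nsq (x - 0)), 0.
  by exists 0 => _ [y _ <-]; exact: nsq_ge0.
have hd s : S s -> inf E <= nsq (x - s).
  by move=> Ss; apply: ge_inf; [case: E0|exists s].
have hy n : exists y, S y /\ nsq (x - y) <= inf E + (n.+1%:R^-1) ^+ 2.
  have [|_ [y Sy <-] /ltW hy] := @inf_adherent _ E ((n.+1%:R^-1) ^+ 2) _ E0.
    by rewrite exprn_gt0.
  by exists y.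
have [y {}hy] := choice hy.
have Sy n : S (y n) by case: (hy n).
have o n s : S s -> `|rip (x - y n) s| <= n.+1%:R^-1 * nr s.
  by apply: (nearest_point_orth _ (Sy n) hd (hy n).2); rewrite invr_ge0.
have yy n m : nr (y n - y m) <= n.+1%:R^-1 + m.+1%:R^-1.
  set w := y n - y m.
  have Sw : S w by exact: subspaceB.
  have := ler_normlW (o m w Sw); have := ler_normlW (o n (- w) (subspaceN Sw)).
  rewrite ripNr nrN => h1 h2.
  have : nr w ^+ 2 <= (n.+1%:R^-1 + m.+1%:R^-1) * nr w.
    rewrite nr_sqr; have -> : nsq w = rip (x - y m) w - rip (x - y n) w.
      by rewrite -ripNl -ripDl opprB addrC subrKA.
    by rewrite mulrDl addrC lerD.
  have [->|w0] := eqVneq (nr w) 0; first by rewrite addr_ge0.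
  by rewrite expr2 ler_pM2r// lt_neqAle eq_sym w0 nr_ge0.
have [|l yl] := @hcauchy y.
  move=> e e0; have [N hN] := invS_lt (divr_gt0 e0 (ltr0Sn _ 1)).
  exists N => n m Nn Nm; apply: le_lt_trans (yy n m) _.
  by rewrite [ltRHS]splitr ltrD ?hN.
have Sl : S l by exact: hcvg_closed clS Sy yl.
exists l; split => //; apply: orth_inner => s Ss; apply/eqP; rewrite -normr_le0.
apply/ler_addgt0Pr => e e0; rewrite add0r.
have s1 : 0 < nr s + 1 by rewrite ltr_wpDl ?nr_ge0.
have e'0 : 0 < e / (nr s + 1) / 2 by rewrite !divr_gt0.
have [N hN] := invS_lt e'0; have [N' hN'] := yl _ e'0.
pose n := maxn N N'.
have := hN n (leq_maxl _ _); have := hN' n (leq_maxr _ _).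
have -> : rip (x - l) s = rip (x - y n) s + rip (y n - l) s.
  by rewrite -ripDl addrA subrK.
move=> h1 h2; apply: le_trans (ler_normD _ _) _.
have h3 := o n s Ss.
have h4 : `|rip (y n - l) s| <= nr (y n - l) * nr s.
  by rewrite ler_norml rip_le andbT -nrN -lerNl -ripNl rip_le.
have -> : e = (e / (nr s + 1) / 2 + e / (nr s + 1) / 2) * (nr s + 1).
  by field; rewrite gt_eqF.
apply: le_trans (lerD h3 h4) _.
set e' := e / _ / _ in e'0 h1 h2 *.
apply: (@le_trans _ _ ((e' + e') * nr s)); last first.
  by rewrite ler_wpM2l ?addr_ge0 ?(ltW e'0)// lerDl.
by rewrite mulrDl lerD// ler_wpM2r ?nr_ge0// ltW.
Qed.

Definition proj : H -> H :=
  if pselect (exists P, orthogonal_projection S P) is left e then sval (cid e)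
  else id.

Lemma projP : orthogonal_projection S proj.
Proof.
rewrite /proj; case: pselect => [e|[]]; first exact: svalP (cid e).
exact: orthogonal_projection_exists.
Qed.

Lemma proj_in x : S (proj x). Proof. by case: (projP x). Qed.
Lemma proj_orth x y : S y -> inner (x - proj x) y = 0.
Proof. by case: (projP x) => _; exact. Qed.

Lemma proj_uniq x y : S y -> (forall s, S s -> inner (x - y) s = 0) -> proj x = y.
Proof.
move=> Sy h; apply/eqP; rewrite -subr_eq0; apply/eqP/nsq_eq0.
have Sw : S (proj x - y) by apply: subspaceB => //; exact: proj_in.
have e : proj x - y = (x - y) - (x - proj x) by rewrite opprB [RHS]addrC subrKA.
by rewrite /nsq {1}e /rip innerBl h// proj_orth// subrr.
Qed.

Lemma proj_id x : S x -> proj x = x.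
Proof. by move=> Sx; apply: proj_uniq => // s _; rewrite subrr inner0l. Qed.

Lemma projK x : proj (proj x) = proj x.
Proof. exact/proj_id/proj_in. Qed.

Lemma proj_linear : linear proj.
Proof.
move=> a x y; apply: proj_uniq.
  by apply: subspaceD; [apply: subspaceZ|]; exact: proj_in.
move=> s Ss; have -> : a *: x + y - (a *: proj x + proj y) =
    a *: (x - proj x) + (y - proj y) by rewrite scalerBr addrACA opprD.
by rewrite innerDl innerZl !proj_orth// mulr0 addr0.
Qed.

Lemma proj_sa x y : inner (proj x) y = inner x (proj y).
Proof.
have h u v : inner (proj u) v = inner (proj u) (proj v).
  apply/eqP; rewrite -subr_eq0 -innerBr innerC proj_orth ?rmorph0//.
  exact: proj_in.
by rewrite h [RHS]innerC [in RHS]h -innerC.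
Qed.

Lemma nsq_proj x : nsq x = nsq (proj x) + nsq (x - proj x).
Proof.
have /(congr1 (@complex.Re _)) := proj_orth x (proj_in x).
by rewrite -/(rip _ _) nsqB /nsq !ripE /= => /eqP; rewrite subr_eq0 => /eqP ->; ring.
Qed.

End Projection.

End RealInner.

(** * Bounded, rank-one and compact operators *)

Section LinearTheory.
Context {K : pzRingType} {V W : lmodType K}.
Variable T : V -> W.
Hypothesis lT : linear T.
Implicit Types (x y : V) (a : K).
Lemma lin0 : T 0 = 0.
Proof. by have := lT (-1) 0 0; rewrite scaleN1r !addNr scaleN1r addNr. Qed.
Lemma linZ a x : T (a *: x) = a *: T x.
Proof. by have := lT a x 0; rewrite lin0 !addr0. Qed.
Lemma linD x y : T (x + y) = T x + T y.
Proof. by have := lT 1 x y; rewrite !scale1r. Qed.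
Lemma linN x : T (- x) = - T x.
Proof. by rewrite -scaleN1r linZ scaleN1r. Qed.
Lemma linB x y : T (x - y) = T x - T y.
Proof. by rewrite linD linN. Qed.
End LinearTheory.

Section Operators.
Context {R : realType} {H : hilbertType R}.
Implicit Types (x y z u v : H) (a : R[i]) (S T : H -> H) (C : R).

Definition bounded_by C T := forall x, nr (T x) <= C * nr x.

Lemma bounded_operatorP T : bounded_operator T <-> linear T /\ exists C, bounded_by C T.
Proof.
split=> -[lT [M hM]]; split=> //; exists M => x.
  by have := hM x; rewrite !normE -rmorphM lecR.
by rewrite !normE -rmorphM lecR hM.
Qed.

Definition rank_one u v : H -> H := fun x => inner x v *: u.

Lemma rank_one_linear u v : linear (rank_one u v).
Proof. by move=> a x y; rewrite /rank_one innerDl innerZl scalerDl scalerA. Qed.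

Lemma Im_inner x y : complex.Im (inner x y) = rip x ('i%C *: y).
Proof.
by rewrite /rip innerZr; case: (inner x y) => p q /=; rewrite mul0r sub0r mulN1r opprK.
Qed.

Lemma nsqi x : nsq ('i%C *: x) = nsq x.
Proof.
rewrite /nsq /rip innerZl innerZr; case: (inner x x) => p q /=.
by rewrite !(mul0r, sub0r, mulN1r, mul1r, opprK, add0r).
Qed.

Lemma nri x : nr ('i%C *: x) = nr x. Proof. by rewrite /nr nsqi. Qed.

Lemma scale_ri a u :
  a *: u = (complex.Re a)%:C%C *: u + (complex.Im a)%:C%C *: ('i%C *: u).
Proof.
rewrite scalerA -scalerDl; congr (_ *: _); case: a => p q /=.
by apply/eqP; rewrite eq_complex /= !(mulr0, mul0r, mulr1, subr0, addr0, add0r) !eqxx.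
Qed.

Lemma rip_norm_le x y : `|rip x y| <= nr x * nr y.
Proof. by rewrite ler_norml rip_le andbT -(nrN x) lerNl -ripNl rip_le. Qed.

Lemma rank_one_bounded_by u v : bounded_by (2 * nr u * nr v) (rank_one u v).
Proof.
move=> x; rewrite /rank_one scale_ri; apply: le_trans (nr_triangle _ _) _.
rewrite !nrZ nri Im_inner -/(rip x v).
have h1 := rip_norm_le x v; have := rip_norm_le x ('i%C *: v); rewrite nri => h2.
by have := nr_ge0 u; nra.
Qed.

Lemma rank_one_bounded u v : bounded_operator (rank_one u v).
Proof.
apply/bounded_operatorP; split; first exact: rank_one_linear.
by exists (2 * nr u * nr v); exact: rank_one_bounded_by.
Qed.

Lemma continuous_real_scale u : continuous (fun t : R => t%:C%C *: u).
Proof.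
move=> t; apply/cvgrPdist_lt => -[e e']; rewrite ltcE/= => /andP[/eqP e'0 e0].
have u1 : 0 < nr u + 1 by rewrite ltr_wpDl ?nr_ge0.
have d0 : 0 < e / (nr u + 1) by rewrite divr_gt0.
have /= := nbhsx_ballx (t : R) _ d0; rewrite -ball_normE.
apply: filterS => s /=; rewrite /ball_/= => hs.
rewrite -scalerBl -rmorphB normE nrZ e'0 (ltcR _ e).
move: hs; rewrite ltr_pdivlMr// mulrDr mulr1; apply: le_lt_trans.
by rewrite lerDl.
Qed.

(** The image of the unit ball lies in the image of a square of R ^ 2 under a continuous
    map. *)
Lemma rank_one_compact u v : compact_operator (rank_one u v).
Proof.
split; first exact: rank_one_linear.
pose I := `[- nr v, nr v]%classic : set R.
pose g (p : R * R) := (p.1)%:C%C *: u + (p.2)%:C%C *: ('i%C *: u).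
apply: (@precompact_subset _ _ (g @` (I `*` I))).
  move=> _ [x x1 <-]; exists (rip x v, rip x ('i%C *: v)); last first.
    by rewrite /g /= /rank_one [RHS]scale_ri Im_inner.
  have nx1 : nr x <= 1 by move: x1; rewrite /= normE -[1]/(1%:C%C) lecR.
  have h1 := rip_norm_le x v; have h2 := rip_norm_le x ('i%C *: v).
  have nv := nr_ge0 v; rewrite nri in h2.
  split; rewrite /I /= in_itv/= -ler_norml.
    by apply: le_trans h1 _; rewrite ler_piMl.
  by apply: le_trans h2 _; rewrite ler_piMl.
apply: compact_precompact; first exact: norm_hausdorff.
apply: continuous_compact; last by apply: compact_setX; exact: segment_compact.
apply: continuous_subspaceT => p.
have c1 (w : H) (f : R * R -> R) : {for p, continuous f} ->
    {for p, continuous ((fun t : R => t%:C%C *: w) \o f)}.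
  by move=> cf; apply: continuous_comp => //; exact: continuous_real_scale.
by apply: cvgD; apply: c1; [exact: cvg_fst|exact: cvg_snd].
Qed.

(** An ultrafilter on the image of the unit ball under T is mapped by an approximation S
    to a compact set, where it clusters; hence it is concentrated on small balls, and
    completeness applies. *)
Lemma compact_operator_lim T : linear T ->
  (forall e : R, 0 < e -> exists2 S, compact_operator S &
     forall x, nr x <= 1 -> nr (T x - S x) <= e) ->
  compact_operator T.
Proof.
move=> lT h; split=> //; rewrite precompactE compact_ultra.
pose B := [set x : H | `|x| <= 1]; rewrite -/B; have B1 x : B x -> nr x <= 1.
  by rewrite /B /= normE -[1]/(1%:C%C) lecR.
move=> F UF FA.
have cF : cauchy F.
  apply/cauchyP => -[e e']; rewrite ltcE/= => /andP[/eqP e'0 e0].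
  have e4 : 0 < e / 4 by rewrite divr_gt0.
  have [S [_ cS] TS] := h _ e4; move: cS; rewrite precompactE => cS.
  have /choice[k hk] y : exists k, closure (T @` B) y ->
      closure (S @` B) k /\ nr (y - k) < e / 4 + e / 4.
    have [Ay|nA] := pselect (closure (T @` B) y); last by exists y.
    move/closureP: (Ay) => /(_ _ e4)[_ [x Bx <-] yx]; exists (S x) => _; split.
      by apply: subset_closure; exists x.
    rewrite -(subrKA (T x)); apply: le_lt_trans (nr_triangle _ _) _.
    by apply: ltr_leD => //; apply: TS; exact: B1.
  have [|z [Sz cz]] := cS (k @ F).
    exact: (@filterS _ F _ _ _ (fun y hy => (hk y hy).1) FA).
  exists z; rewrite e'0.
  have [Fz|Fz] := in_ultra_setVsetC [set y | nr (k y - z) < e / 4] UF.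
    apply: filterS2 FA Fz => y /hk[_ hy] /= kz.
    rewrite -ball_normE/= /ball_/= normE (ltcR _ e) nrBC -(subrKA (k y)).
    apply: le_lt_trans (nr_triangle _ _) _; lra.
  have [||w [hy hz]] := cz [set k y | y in ~` [set y | nr (k y - z) < e / 4]]
       (ball z (e / 4)%:C%C).
  - by apply: (@filterS _ F _ _ _ _ Fz) => y hy; exists y.
  - by apply: nbhsx_ballx; rewrite ltcR.
  case: hy hz => y /= hy <-; rewrite -ball_normE/= /ball_/= normE ltcR nrBC.
  by move=> /hy.
have Fl : F --> lim F by apply/cauchy_cvgP.
exists (lim F); split=> //.
rewrite (closure_id (closure _)).1; last exact: closed_closure.
move=> V /Fl FV; exact: (@filter_ex _ F _ _ (filterI FA FV)).
Qed.

Lemma nrZc (k : R[i]) x : nr (k *: x) = complex.Re `|k| * nr x.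
Proof.
have rk : (complex.Re `|k|)%:C%C = `|k| by rewrite RRe_real// normr_real.
by apply: complexI; rewrite rmorphM/= rk -!normE normrZ.
Qed.

Lemma le_small_eq0 (x : H) (C : R) (e : nat -> R) :
  (forall d, 0 < d -> exists n, e n < d) -> 0 <= C ->
  (forall n, nr x <= e n * C) -> x = 0.
Proof.
move=> e0 C0 h; apply: nr_eq0; apply/eqP; rewrite eq_le nr_ge0 andbT.
have C1 : 0 < C + 1 by rewrite ltr_wpDl.
apply/ler_addgt0Pr => d d0; rewrite add0r.
have [n hn] := e0 _ (divr_gt0 d0 C1).
apply: le_trans (h n) _; apply: le_trans (ler_wpM2r C0 (ltW hn)) _.
by rewrite mulrAC ler_pdivrMr// ler_wpM2l ?(ltW d0)// lerDl.
Qed.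

Lemma bounded_by_add (S T : H -> H) (C D : R) :
  bounded_by C S -> bounded_by D T -> bounded_by (C + D) (fun x => S x + T x).
Proof.
by move=> hS hT x; rewrite mulrDl; apply: le_trans (nr_triangle _ _) (lerD _ _).
Qed.

Lemma bounded_by_le (T : H -> H) (C D : R) : C <= D -> bounded_by C T -> bounded_by D T.
Proof. by move=> CD hT x; apply: le_trans (hT x) _; rewrite ler_wpM2r ?nr_ge0. Qed.

(** Take v = C^-1 T u. *)
Lemma bounded_by_form (T : H -> H) (C : R) : 0 < C ->
  (forall u v, 2 * rip (T u) v <= C * (nsq u + nsq v)) -> bounded_by C T.
Proof.
move=> C0 h u; rewrite nr_le ?mulr_ge0 ?(ltW C0) ?nr_ge0// exprMn nr_sqr.
have := h u ((C^-1)%:C%C *: T u); rewrite ripZr -/(nsq _) nsqZ.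
set p := nsq (T u); set q := nsq u => h1.
have : C * (2 * (C^-1 * p)) <= C * (C * (q + C^-1 ^+ 2 * p)) by rewrite ler_wpM2l// ltW.
have -> : C * (2 * (C^-1 * p)) = 2 * p by field; rewrite gt_eqF.
have -> : C * (C * (q + C^-1 ^+ 2 * p)) = C ^+ 2 * q + p by field; rewrite gt_eqF.
by lra.
Qed.

(** T maps the unit ball into a multiple of the unit ball. *)
Lemma compact_bounded_comp (S T : H -> H) :
  compact_operator S -> bounded_operator T -> compact_operator (S \o T).
Proof.
move=> [lS cS] bT; have [lT [C hC]] := (bounded_operatorP T).1 bT.
split; first by move=> k x y /=; rewrite lT lS.
pose D := `|C| + 1; have D0 : 0 < D by rewrite ltr_wpDl.
have := compact_operator_lin D%:C%C (conj lS cS) (compact_operator0 H).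
rewrite addr0 => -[_]; apply: precompact_subset => _ [x x1 <-].
exists ((D^-1)%:C%C *: T x).
  rewrite /= normE -[1]/(1%:C%C) lecR nrZ gtr0_norm ?invr_gt0// mulrC ler_pdivrMr// mul1r.
  apply: le_trans (hC x) _; move: x1; rewrite /= normE -[1]/(1%:C%C) lecR => x1.
  apply: le_trans (_ : `|C| * nr x <= _); first by rewrite ler_wpM2r ?nr_ge0 ?ler_norm.
  by apply: (@le_trans _ _ `|C|); rewrite ?ler_piMr// lerDl.
rewrite -[LHS]/(D%:C%C *: S ((D^-1)%:C%C *: T x)) (linZ lS).
by rewrite scalerA -rmorphM/= mulfV ?scale1r// gt_eqF.
Qed.

End Operators.

(** * The compact operators of Alg L as a complete algebra *)

Section CompactAlg.
Context {R : realType} {H : hilbertType R}.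
Variable L : subspace_lattice H.
Local Notation A := (compact_Alg L).
Implicit Types (a b s : A) (x y u : H).

Lemma cA_intro (f : H -> H) : bounded_operator f -> compact_operator f ->
  (forall S, L S -> forall x, S x -> S (f x)) -> exists a, a = f :> (H -> H).
Proof.
move=> bf cf Lf.
have Pf : Alg_pred L f.
  by apply/asboolP; split=> // S LS _ [x Sx <-]; exact: Lf.
have Pc : compact_Alg_pred (MkAlg Pf) by apply/asboolP.
by exists (MkCompactAlg Pc).
Qed.

Lemma cA_bounded a : bounded_operator a.
Proof. by have /asboolP[] := valP (val a). Qed.
Lemma cA_compact a : compact_operator a.
Proof. by have /asboolP := valP a. Qed.
Lemma cA_linear a : linear a. Proof. by case: (cA_bounded a). Qed.
Lemma cA_inv a S x : L S -> S x -> S (a x).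
Proof. by move=> LS Sx; have /asboolP[_ h] := valP (val a); apply: h LS _ _; exists x. Qed.
Lemma cA_bounded_by a : exists2 C, 0 <= C & bounded_by C a.
Proof.
have /bounded_operatorP[_ [C hC]] := cA_bounded a; exists `|C| => // x.
by apply: le_trans (hC x) _; rewrite ler_wpM2r ?nr_ge0// ler_norm.
Qed.
Lemma cA_ext a b : (forall x, a x = b x) -> a = b.
Proof. by move=> h; apply/val_inj/val_inj/funext. Qed.

Lemma cA_addE a b x : (a + b) x = a x + b x. Proof. by []. Qed.
Lemma cA_oppE a x : (- a) x = - a x. Proof. by []. Qed.
Lemma cA_subE a b x : (a - b) x = a x - b x. Proof. by []. Qed.
Lemma cA_scaleE k a x : (k *: a) x = k *: a x. Proof. by []. Qed.
Lemma cA_mulE a b x : (amul a b) x = a (b x). Proof. by []. Qed.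
Lemma cA_0E x : (0 : A) x = 0. Proof. by []. Qed.

(** The pointwise limit is a limit in norm, hence compact, and it leaves the members of L
    invariant because they are closed. *)
Lemma cA_complete (s : nat -> A) (e : nat -> R) :
  (forall d, 0 < d -> exists n, e n < d) ->
  (forall n m, (n <= m)%N -> bounded_by (e n) (s m - s n)) ->
  exists t : A, forall n, bounded_by (e n) (t - s n).
Proof.
move=> e0 se.
have hl x : exists l, hcvg (fun n => s n x) l.
  apply: hcauchy => d d0.
  have d1 : 0 < d / (nr x + 1) / 2 by rewrite !divr_gt0// ltr_wpDl ?nr_ge0.
  have [N hN] := e0 _ d1; exists N => n m Nn Nm.
  have := se _ _ Nn x; have := se _ _ Nm x; rewrite !cA_subE => h1 h2.
  rewrite -(subrKA (s N x)).
  apply: le_lt_trans (nr_triangle _ _) _; rewrite (nrBC (s N x)).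
  apply: le_lt_trans (lerD h2 h1) _.
  have -> : d = (d / (nr x + 1) / 2 + d / (nr x + 1) / 2) * (nr x + 1).
    by field; rewrite gt_eqF// ltr_wpDl ?nr_ge0.
  set d' := d / _ / _ in d1 hN *; have := nr_ge0 x; nra.
have [l hl'] := choice hl.
have le n x : nr (l x - s n x) <= e n * nr x.
  apply/ler_addgt0Pr => d d0; have [N hN] := hl' x _ d0.
  have := hN _ (leq_maxl N n); have := se _ _ (leq_maxr N n) x.
  rewrite cA_subE => h1 h2; rewrite -(subrKA (s (maxn N n) x)).
  apply: le_trans (nr_triangle _ _) _; rewrite (nrBC (l x)) addrC lerD//.
  exact: ltW.
have ll : linear l.
  move=> k x y; apply/eqP; rewrite -subr_eq0; apply/eqP.
  pose C := nr (k *: x + y) + complex.Re `|k| * nr x + nr y.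
  have Rk : 0 <= complex.Re `|k|.
    by rewrite -ler0c RRe_real ?normr_real.
  apply: (@le_small_eq0 _ _ _ C e) => // [|n].
    by rewrite !addr_ge0 ?mulr_ge0 ?nr_ge0.
  have [d dE dle] : exists2 d : H -> H, (forall z, l z = s n z + d z) &
      forall z, nr (d z) <= e n * nr z.
    by exists (fun z => l z - s n z) => z; rewrite ?le// addrC subrK.
  have -> : l (k *: x + y) - (k *: l x + l y) = d (k *: x + y) - (k *: d x + d y).
    by rewrite !dE cA_linear scalerDr addrACA (addrC (k *: s n x + s n y)) addrKA.
  apply: le_trans (nr_triangle _ _) _; rewrite nrN /C -addrA mulrDr lerD ?dle//.
  apply: le_trans (nr_triangle _ _) _; rewrite nrZc mulrDr lerD ?dle// mulrCA.
  by rewrite ler_wpM2l ?dle.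
have [||S LS x Sx|t tl] := @cA_intro l.
- apply/bounded_operatorP; split=> //; have [C C0 hC] := cA_bounded_by (s 0%N).
  exists (e 0%N + C) => x; rewrite -(subrK (s 0%N x) (l x)) mulrDl.
  by apply: le_trans (nr_triangle _ _) _; rewrite lerD ?le ?hC.
- apply: compact_operator_lim => // d d0; have [n hn] := e0 _ d0.
  exists (s n) => [|x x1]; first exact: cA_compact.
  apply: le_trans (le n x) _; have := nr_ge0 x; nra.
- by apply: hcvg_closed (hl' x) => [|n]; [case: (sl_closed LS)|exact: cA_inv].
by exists t => n x; rewrite cA_subE tl.
Qed.

Lemma bounded_by_opp (a : A) (C : R) : bounded_by C a -> bounded_by C (- a).
Proof. by move=> h x; rewrite cA_oppE nrN. Qed.

Lemma bounded_by_scale (a : A) (C r : R) : bounded_by C a -> bounded_by (`|r| * C) (r%:C%C *: a).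
Proof. by move=> h x; rewrite cA_scaleE nrZ -mulrA ler_wpM2l. Qed.

(** The uniform boundedness principle for families of seminorms on A, by a gliding hump:
    s_(n+1) is obtained from s_n by a perturbation of norm r_n that makes some seminorm
    at least n + 1, and r_(n+1) is so small that later perturbations change it by at most
    1.  The limit of s_n violates pointwise boundedness. *)
Lemma cA_uniform_bounded (I : Type) (psi : I -> A -> R) :
  (forall i a b, psi i (a + b) <= psi i a + psi i b) ->
  (forall i a, psi i (- a) = psi i a) ->
  (forall i (r : R) a, 0 <= r -> psi i (r%:C%C *: a) = r * psi i a) ->
  (forall i, exists C, forall m a, 0 <= m -> bounded_by m a -> psi i a <= C * m) ->
  (forall a, exists B, forall i, psi i a <= B) ->
  exists K, forall i a, bounded_by 1 a -> psi i a <= K.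
Proof.
move=> psiD psiN psiZ psiC psiB; apply: contrapT => nK.
have {nK} hK K : exists i a, bounded_by 1 a /\ K < psi i a.
  apply: contrapT => h; apply: nK; exists K => i a a1; rewrite leNgt.
  by apply/negP => Ka; apply: h; exists i, a.
have step (p : nat * (A * R)) : exists q : A * R, 0 < p.2.2 ->
    [/\ 0 < q.2, 2 * q.2 <= p.2.2, bounded_by p.2.2 (q.1 - p.2.1) &
      exists i, forall s, bounded_by (2 * q.2) (s - q.1) -> p.1%:R <= psi i s].
  case: p => n [s r] /=; have [r0|r0] := ltP 0 r; last by exists (0, 0).
  have [i [a [a1 ia]]] := hK ((n%:R + 1) / r).
  have [C hC] := psiC i; pose C' := `|C| + 1.
  have C'0 : 0 < C' by rewrite ltr_wpDl.
  have [s' ss' is'] : exists2 s', bounded_by r (s' - s) & n%:R + 1 <= psi i s'.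
    (* s + r a and s - r a differ by 2 r a, so psi i is large at one of them. *)
    have ra : n%:R + 1 < psi i (r%:C%C *: a).
      by rewrite psiZ ?(ltW r0)// mulrC -ltr_pdivrMr.
    have br : bounded_by r (r%:C%C *: a).
      by have := bounded_by_scale r a1; rewrite mulr1 gtr0_norm.
    have := psiD i (s + r%:C%C *: a) (- (s - r%:C%C *: a)).
    rewrite psiN opprB addrCA addrAC subrr add0r.
    have -> : r%:C%C *: a + r%:C%C *: a = 2%:C%C *: (r%:C%C *: a).
      by rewrite -mulr2n -scaler_nat rmorph_nat.
    rewrite psiZ// => h2.
    have [h|h] := leP (n%:R + 1) (psi i (s + r%:C%C *: a)).
      by exists (s + r%:C%C *: a) => //; rewrite addrC addKr.
    exists (s - r%:C%C *: a); last by lra.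
    by rewrite addrC addKr; exact: bounded_by_opp.
  pose r' := Num.min (r / 2) (1 / C' / 2).
  have r'0 : 0 < r' by rewrite lt_min !divr_gt0.
  have r'1 : 2 * r' <= r.
    by rewrite mulrC -ler_pdivlMr// ge_min lexx.
  have r'2 : C' * (2 * r') <= 1.
    by rewrite mulrC -ler_pdivlMr// mulrC -ler_pdivlMr// ge_min lexx orbT.
  exists (s', r') => _; split=> //=; exists i => t bt.
  have := psiD i t (s' - t); rewrite addrC subrK => h1.
  have : psi i (s' - t) <= C * (2 * r').
    apply: hC; first by rewrite mulr_ge0// ltW.
    by rewrite -opprB; exact: bounded_by_opp.
  have : C * (2 * r') <= C' * (2 * r').
    rewrite ler_wpM2r ?mulr_ge0 ?(ltW r'0)// /C'.
    by rewrite (le_trans (ler_norm C))// lerDl.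
  by lra.
have [f hf] := choice step.
pose st := fix st n : A * R := if n is n'.+1 then f (n', st n') else (0, 1).
have st0 n : 0 < (st n).2.
  by elim: n => //= n IH; have [] := hf (n, st n) IH.
have stS n : [/\ 2 * (st n.+1).2 <= (st n).2, bounded_by (st n).2 ((st n.+1).1 - (st n).1) &
      exists i, forall s, bounded_by (2 * (st n.+1).2) (s - (st n.+1).1) -> n%:R <= psi i s].
  by have [_ ? ? ?] := hf (n, st n) (st0 n).
have [||t ht] := @cA_complete (fun n => (st n).1) (fun n => 2 * (st n).2).
- move=> d d0; have [N hN] := invS_lt d0; exists N.+1.
  have [h _ _] := stS N; apply: le_lt_trans h _; apply: le_lt_trans (hN N (leqnn N)).
  elim: {hN} N => [|N IH]; first by rewrite /= invr1.
  have [h _ _] := stS N; rewrite -ler_pdivlMl// in h.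
  apply: le_trans h _; apply: le_trans (ler_wpM2l _ IH) _; rewrite ?invr_ge0//.
  rewrite -invfM lef_pV2 ?posrE ?mulr_gt0// -natrM ler_nat.
  by rewrite mul2n -addnn addSn ltnS leq_addl.
- move=> n m nm.
  suff h : bounded_by (2 * (st n).2 - 2 * (st m).2) ((st m).1 - (st n).1).
    by apply: bounded_by_le h; rewrite lerBlDr lerDl mulr_ge0// ltW.
  elim: m nm => [|m IH]; first by rewrite leqn0 => /eqP-> x; rewrite !subrr cA_0E nr0 mul0r.
  rewrite leq_eqVlt => /predU1P[<- x|]; first by rewrite !subrr cA_0E nr0 mul0r.
  rewrite ltnS => /IH h; have [h1 h2 _] := stS m.
  have -> : (st m.+1).1 - (st n).1 = ((st m.+1).1 - (st m).1) + ((st m).1 - (st n).1).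
    by rewrite subrKA.
  by apply: bounded_by_le (bounded_by_add h2 h); lra.
have [B hB] := psiB t.
have [n Bn] : exists n, B < n%:R :> R.
  by exists (Num.bound `|B|); apply: le_lt_trans (ler_norm B) (archi_boundP _).
have [_ _ [i hi]] := stS n.
by have := hi t (ht n.+1); have := hB i; lra.
Qed.

End CompactAlg.

(** * Multipliers are given by operators *)

Section Multipliers.
Context {R : realType} {H : hilbertType R}.
Variable L : subspace_lattice H.
Local Notation A := (compact_Alg L).
Implicit Types (a b s : A) (x y z u : H).

(** The a depends on x, and q is fixed: iterating the choice on x - a x makes the error
    arbitrarily small. *)
Definition approx_unit := exists C q : R, [/\ 0 < C, 0 <= q, q < 1 &
  forall x, exists a, bounded_by C a /\ nr (x - a x) <= q * nr x].

Hypothesis unitA : approx_unit.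

Lemma cA_separating x : (forall a, a x = 0) -> x = 0.
Proof.
move=> x0; have [C [q [_ q0 q1 h]]] := unitA; have [a [_]] := h x.
rewrite x0 subr0 => h1; apply: nr_eq0.
by have := nr_ge0 x; nra.
Qed.

Variables Lm Rm : A -> A.
Hypothesis mLR : is_multiplier (Lm, Rm).

(** The right-hand side is continuous in a, whatever Lm is. *)
Lemma mult_LR a b x : b (Lm a x) = Rm b (a x).
Proof. by case: mLR => _ _ _ _ /(_ b a) /(congr1 (fun f : A => f x)). Qed.

(** The seminorms |b (Lm a u)| = |Rm b (a u)| are continuous in a and pointwise bounded,
    and approximate units b for the vector Lm a u make them comparable to |Lm a u|. *)
Lemma left_multiplier_bounded (C : R) : 0 < C ->
  exists2 c, 0 <= c & forall a, bounded_by C a -> bounded_by c (Lm a).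
Proof.
move=> C0; have [lL _ _ _ _] := mLR.
have [D [q [D0 q0 q1 hu]]] := unitA.
pose I := {p : A * H | bounded_by D p.1 /\ nr p.2 <= 1}.
pose psi (i : I) a := nr ((sval i).1 (Lm a (sval i).2)).
have [i a b|i a|i r a r0|i|a|K hK] := @cA_uniform_bounded _ _ L I psi.
- by rewrite /psi (linD lL) cA_addE (linD (cA_linear _)) nr_triangle.
- by rewrite /psi (linN lL) cA_oppE (linN (cA_linear _)) nrN.
- by rewrite /psi (linZ lL) cA_scaleE (linZ (cA_linear _)) nrZ ger0_norm.
- case: i => -[b u] [/= bD u1]; have [c c0 hc] := cA_bounded_by (Rm b).
  exists c => m a m0 am; rewrite /psi/= mult_LR; apply: le_trans (hc _) _.
  rewrite ler_wpM2l//; apply: le_trans (am _) _.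
  by rewrite ler_piMr.
- have [c c0 hc] := cA_bounded_by (Lm a); exists (D * c) => -[[b u] [/= bD u1]].
  rewrite /psi/=; apply: le_trans (bD _) _; rewrite ler_wpM2l ?(ltW D0)//.
  by apply: le_trans (hc _) _; rewrite ler_piMr.
pose K' := `|K| / (1 - q); have q1' : 0 < 1 - q by rewrite subr_gt0.
have K'0 : 0 <= K' by rewrite divr_ge0// ltW.
have h1 a u : bounded_by 1 a -> nr u <= 1 -> nr (Lm a u) <= K'.
  move=> a1 u1; have [b [bD hb]] := hu (Lm a u).
  have := hK (exist _ (b, u) (conj bD u1)) a a1; rewrite /psi/= => h2.
  rewrite ler_pdivlMr// mulrBr mulr1 lerBlDr mulrC.
  rewrite -{1}(subrK (b (Lm a u)) (Lm a u)) addrC.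
  apply: le_trans (nr_triangle _ _) (lerD _ hb).
  exact: le_trans h2 (ler_norm K).
exists (C * K') => [|a aC u]; first by rewrite mulr_ge0// ltW.
pose a' := (C^-1)%:C%C *: a.
have a'1 : bounded_by 1 a'.
  by have := bounded_by_scale C^-1 aC; rewrite gtr0_norm ?invr_gt0// mulVf// gt_eqF.
have -> : Lm a u = C%:C%C *: Lm a' u.
  rewrite (linZ lL) cA_scaleE scalerA -rmorphM/= mulfV ?scale1r// gt_eqF//.
rewrite nrZ gtr0_norm// -mulrA ler_wpM2l ?(ltW C0)//.
have [u0|u0] := eqVneq (nr u) 0.
  by rewrite (nr_eq0 u0) (lin0 (cA_linear _)) nr0 mulr0.
have pu : 0 < nr u by rewrite lt_neqAle eq_sym u0 nr_ge0.
have := h1 a' ((nr u)^-1%:C%C *: u) a'1.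
rewrite (linZ (cA_linear _)) !nrZ gtr0_norm ?invr_gt0// mulVf// mulrC ler_pdivrMr//.
exact.
Qed.

(** With approximate units a_k for x_k = x_(k-1) - a_(k-1) x_(k-1), the vector x is the
    sum of the a_k x_k, and T x is the sum of the Lm a_k x_k. *)
Lemma multiplier_operator : exists T : H -> H,
  [/\ bounded_operator T, (forall S, L S -> forall x, S x -> S (T x)),
      (forall a x, Lm a x = T (a x)) & (forall a x, Rm a x = a (T x))].
Proof.
have [C [q [C0 q0 q1 hu]]] := unitA.
have [e he] := choice hu.
have [c c0 hc] := left_multiplier_bounded C0.
have q1' : 0 < 1 - q by rewrite subr_gt0.
pose xs x n := iter n (fun y => y - e y y) x.
have xsS x n : xs x n.+1 = xs x n - e (xs x n) (xs x n) by [].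
have xs_le x n : nr (xs x n) <= q ^+ n * nr x.
  elim: n => [|n IH]; first by rewrite expr0 mul1r.
  have [_ h] := he (xs x n); apply: le_trans h _.
  by rewrite exprS -mulrA ler_wpM2l.
pose zs x n := \sum_(k < n) Lm (e (xs x k)) (xs x k).
have zsS x n : zs x n.+1 = zs x n + Lm (e (xs x n)) (xs x n) by rewrite /zs big_ord_recr.
have [c' c'0 c'E] : exists2 c', 0 <= c' & c' * (1 - q) = c.
  exists (c / (1 - q)); first by rewrite divr_ge0// ltW.
  by rewrite divfK// gt_eqF.
have zs_le x n m : (n <= m)%N -> nr (zs x m - zs x n) <= c' * (q ^+ n - q ^+ m) * nr x.
  elim: m => [|m IH]; first by rewrite leqn0 => /eqP->; rewrite !subrr nr0 mulr0 mul0r.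
  rewrite leq_eqVlt => /predU1P[<-|]; first by rewrite !subrr nr0 mulr0 mul0r.
  rewrite ltnS => /IH {}IH; rewrite zsS addrAC.
  apply: le_trans (nr_triangle _ _) _.
  have -> : q ^+ n - q ^+ m.+1 = (q ^+ n - q ^+ m) + (1 - q) * q ^+ m by rewrite exprS; ring.
  rewrite mulrDr mulrDl lerD// mulrA c'E.
  have [h _] := he (xs x m); apply: le_trans (hc _ h _) _.
  by rewrite -mulrA ler_wpM2l.
have zs_le' x n m : (n <= m)%N -> nr (zs x m - zs x n) <= q ^+ n * (c' * nr x).
  move=> nm; apply: le_trans (zs_le _ _ _ nm) _.
  rewrite mulrAC mulrC; apply: ler_wpM2r; first by rewrite mulr_ge0 ?nr_ge0.
  by rewrite lerBlDr lerDl exprn_ge0.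
have hz x : exists z, forall n, nr (z - zs x n) <= q ^+ n * (c' * nr x).
  have B0 : 0 <= c' * nr x by rewrite mulr_ge0 ?nr_ge0.
  have [|z zz] := @hcauchy _ _ (zs x).
    move=> d d0; have d2 : 0 < d / 2 / (c' * nr x + 1) by rewrite !divr_gt0// ltr_wpDl.
    have [N hN] := expr_small q0 q1 d2; exists N => n m Nn Nm.
    rewrite -(subrKA (zs x N)) (splitr d).
    apply: le_lt_trans (nr_triangle _ _) _; rewrite (nrBC (zs x N)).
    have hd : q ^+ N * (c' * nr x) < d / 2.
      rewrite ltr_pdivlMr ?ltr_wpDl// in hN.
      by apply: le_lt_trans hN; rewrite ler_wpM2l ?exprn_ge0// lerDl.
    by rewrite ltrD// (le_lt_trans _ hd)// zs_le'.
  exists z => n; apply/ler_addgt0Pr => d d0; have [N hN] := zz _ d0.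
  have := hN _ (leq_maxl N n); have := zs_le' x _ _ (leq_maxr N n) => h1 h2.
  rewrite -(subrKA (zs x (maxn N n))) addrC.
  by apply: le_trans (nr_triangle _ _) _; rewrite (nrBC z) lerD// ltW.
have [T hT] := choice hz.
have bzs b x n : b (zs x n) = Rm b (x - xs x n).
  elim: n => [|n IH]; first by rewrite /zs big_ord0 subrr !(lin0 (cA_linear _)).
  rewrite zsS (linD (cA_linear _)) IH mult_LR -(linD (cA_linear _)) xsS.
  by rewrite opprB -addrA (addrC (- _)).
have bT b x : b (T x) = Rm b x.
  apply/eqP; rewrite -subr_eq0; apply/eqP.
  have [B B0 hB] := cA_bounded_by b; have [B' B'0 hB'] := cA_bounded_by (Rm b).
  apply: (@le_small_eq0 _ _ _ (B * (c' * nr x) + B' * nr x) (fun n => q ^+ n)).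
  - by move=> d d0; exact: expr_small.
  - by apply: addr_ge0; rewrite !mulr_ge0 ?nr_ge0.
  move=> n; rewrite -(subrKA (b (zs x n))); apply: le_trans (nr_triangle _ _) _.
  rewrite -(linB (cA_linear _)) bzs -(linB (cA_linear _)) addrAC subrr add0r.
  rewrite mulrDr; apply: lerD.
    by apply: le_trans (hB _) _; rewrite mulrCA ler_wpM2l.
  by apply: le_trans (hB' _) _; rewrite nrN mulrCA ler_wpM2l.
exists T; split.
- apply/bounded_operatorP; split.
    move=> k x y; apply/eqP; rewrite -subr_eq0; apply/eqP; apply: cA_separating => b.
    rewrite (linB (cA_linear _)) (cA_linear b) !bT.
    by rewrite (cA_linear (Rm b)) subrr.
  exists c' => x; have := hT x 0%N; rewrite /zs big_ord0 subr0 expr0 mul1r; exact.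
- move=> S LS x Sx; have cS := sl_closed LS; have [S0 _ clS] := cS.
  have Sxs n : S (xs x n).
    by elim: n => // n IH; rewrite xsS; apply: subspaceB => //; exact: cA_inv.
  have Szs n : S (zs x n).
    elim: n => [|n IH]; first by rewrite /zs big_ord0.
    by rewrite zsS; apply: subspaceD => //; exact: cA_inv.
  apply: closed_lim => // d d0.
  have B0 : 0 <= c' * nr x by rewrite mulr_ge0 ?nr_ge0.
  have d2 : 0 < d / (c' * nr x + 1) by rewrite !divr_gt0// ltr_wpDl.
  have [N hN] := expr_small q0 q1 d2; exists (zs x N) => //.
  apply: le_lt_trans (hT x N) _; rewrite ltr_pdivlMr ?ltr_wpDl// in hN.
  by apply: le_lt_trans hN; rewrite ler_wpM2l ?exprn_ge0// lerDl.
- move=> a x; apply/eqP; rewrite -subr_eq0; apply/eqP; apply: cA_separating => b.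
  by rewrite (linB (cA_linear _)) mult_LR bT subrr.
- by move=> a x; rewrite bT.
Qed.

End Multipliers.

Section Isomorphism.
Context {R : realType} {H : hilbertType R}.
Variable L : subspace_lattice H.
Local Notation A := (compact_Alg L).
Implicit Types (a b : A) (x : H) (T : Alg L) (u v : multiplier A).

Lemma Alg_bounded T : bounded_operator T.
Proof. by have /asboolP[] := valP T. Qed.
Lemma Alg_linear T : linear T. Proof. by case: (Alg_bounded T). Qed.
Lemma Alg_inv T S x : L S -> S x -> S (T x).
Proof. by move=> LS Sx; have /asboolP[_ h] := valP T; apply: h LS _ _; exists x. Qed.

Lemma compact_Alg_lmul T a : exists b, b = T \o a :> (H -> H).
Proof.
apply: cA_intro; first exact: bounded_operator_comp (Alg_bounded T) (cA_bounded a).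
  exact: compact_operator_comp (Alg_bounded T) (cA_compact a).
by move=> S LS x Sx /=; apply: Alg_inv => //; exact: cA_inv.
Qed.

Lemma compact_Alg_rmul T a : exists b, b = a \o T :> (H -> H).
Proof.
apply: cA_intro; first exact: bounded_operator_comp (cA_bounded a) (Alg_bounded T).
  exact: compact_bounded_comp (cA_compact a) (Alg_bounded T).
by move=> S LS x Sx /=; apply: cA_inv => //; exact: Alg_inv.
Qed.

(** Since A separates points, the operator T of a multiplier is unique, so that choosing it
    is linear and multiplicative; left and right multiplications by T give the inverse. *)
Lemma multiplier_compact_Alg_iso : approx_unit L ->
  alg_isomorphic (multiplier A) (Alg L).
Proof.
move=> unitA.
have sep := cA_separating unitA.
have /choice[f hf] u : exists T, (forall a x, (val u).1 a x = T (a x)) /\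
    (forall a x, (val u).2 a x = a (T x)).
  case: u => -[Lm Rm] /= p; have /asboolP m := p.
  have [T [bT TL TLm TRm]] := multiplier_operator unitA m.
  have PT : Alg_pred L T.
    by apply/asboolP; split=> // S LS _ [x Sx <-]; exact: TL.
  by exists (MkAlg PT).
have uniq T T' : (forall a x, a (T x) = a (T' x)) -> T = T'.
  move=> h; apply/val_inj/funext => x /=; apply/eqP; rewrite -subr_eq0; apply/eqP.
  by apply: sep => a; rewrite (linB (cA_linear a)) h subrr.
have f2 u a x : a (f u x) = (val u).2 a x by rewrite (hf u).2.
exists f; split.
- move=> k u v; apply: uniq => a x; rewrite f2.
  rewrite -[RHS]/(a (k *: f u x + f v x)).
  have e : val (k *: u + v) = k *: val u + val v by exact: linearP.
  have e2 (p q : (A -> A) * (A -> A)) : (k *: p + q).2 = k *: p.2 + q.2 by [].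
  by rewrite e (cA_linear a) (f2 u) (f2 v) e2.
- by move=> u v; apply: uniq => a x; rewrite f2 /= !f2.
- by apply: uniq => a x; rewrite f2.
- have [l hl] := choice (fun p : Alg L * A => compact_Alg_lmul p.1 p.2).
  have [r hr] := choice (fun p : Alg L * A => compact_Alg_rmul p.1 p.2).
  have lE T a x : l (T, a) x = T (a x) by rewrite hl.
  have rE T a x : r (T, a) x = a (T x) by rewrite hr.
  have Pm T : multiplier_pred (fun a => l (T, a), fun a => r (T, a)).
    apply/asboolP; split.
    + move=> k a b; apply: cA_ext => x.
      by rewrite -[RHS]/(k *: l (T, a) x + l (T, b) x) !lE -Alg_linear.
    + by move=> k a b; apply: cA_ext => x; rewrite -[RHS]/(k *: r (T, a) x + r (T, b) x) !rE.
    + by move=> a b; apply: cA_ext => x; rewrite cA_mulE !lE cA_mulE.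
    + by move=> a b; apply: cA_ext => x; rewrite cA_mulE !rE cA_mulE.
    + by move=> a b; apply: cA_ext => x; rewrite !cA_mulE lE rE.
  exists (fun T => Multiplier (Pm T)) => [u|T]; last first.
    by apply: uniq => a x; rewrite f2 /= rE.
  apply/val_inj => /=; have [h1 h2] := hf u; rewrite [RHS]surjective_pairing.
  by congr (_, _); apply/funext => a; apply: cA_ext => x; rewrite ?lE ?rE ?h1 ?h2.
Qed.

End Isomorphism.

(** * Approximate units from lower bounds of quadratic forms *)

Section Coercive.
Context {R : realType} {H : hilbertType R}.
Variable L : subspace_lattice H.
Local Notation A := (compact_Alg L).
Implicit Types (a b : A) (x y u v : H).

(** A form of [approx_unit] that is insensitive to the scaling of a: it is enough that a
    does not shrink x, in the direction of x, below a fixed proportion of its norm. *)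
Definition coercive_unit := exists C d : R, [/\ 0 < C, 0 < d &
  forall x, exists a, bounded_by C a /\ d * nsq x <= rip (a x) x].

(** |x - m a x|^2 <= (1 - 2 m d + m^2 C^2) |x|^2, and m = d / C^2 minimizes the
    bound. *)
Lemma coercive_approx_unit : coercive_unit -> approx_unit L.
Proof.
move=> [C [d' [C0 d'0 h]]].
(* The minimum ensures that d / C is at most 1. *)
pose d := Num.min d' C; have d0 : 0 < d by rewrite lt_min d'0.
have dC : d <= C by rewrite ge_min lexx orbT.
have dd' : d <= d' by rewrite ge_min lexx.
pose t := (d / C) ^+ 2; have t0 : 0 < t by rewrite exprn_gt0// divr_gt0.
have t1 : t <= 1 by rewrite expr_le1 ?divr_ge0 ?(ltW d0) ?(ltW C0)// ler_pdivrMr// mul1r.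
exists (d / C ^+ 2 * C), (1 - t / 2); split; [|lra|lra|].
  by rewrite mulr_gt0// divr_gt0// exprn_gt0.
move=> x; have [a [aC ax]] := h x; exists ((d / C ^+ 2)%:C%C *: a); split.
  have p0 : 0 < d / C ^+ 2 by rewrite divr_gt0// exprn_gt0.
  by have := bounded_by_scale (d / C ^+ 2) aC; rewrite gtr0_norm.
rewrite nr_le ?mulr_ge0 ?nr_ge0//; last by lra.
rewrite exprMn nr_sqr cA_scaleE nsqB ripZr nsqZ ripC.
have hax : nsq (a x) <= C ^+ 2 * nsq x.
  by rewrite -!nr_sqr -exprMn ler_pXn2r ?nnegrE ?mulr_ge0 ?nr_ge0// ltW.
have h1 : d / C ^+ 2 * (d * nsq x) <= d / C ^+ 2 * rip (a x) x.
  rewrite ler_wpM2l ?divr_ge0 ?exprn_ge0 ?(ltW d0) ?(ltW C0)//.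
  by apply: le_trans ax; rewrite ler_wpM2r// nsq_ge0.
have h2 : (d / C ^+ 2) ^+ 2 * nsq (a x) <= (d / C ^+ 2) ^+ 2 * (C ^+ 2 * nsq x).
  by rewrite ler_wpM2l// sqr_ge0.
have e1 : d / C ^+ 2 * (d * nsq x) = t * nsq x by rewrite /t; field; rewrite gt_eqF.
have e2 : (d / C ^+ 2) ^+ 2 * (C ^+ 2 * nsq x) = t * nsq x.
  by rewrite /t; field; rewrite gt_eqF.
have h3 : 0 <= t ^+ 2 * nsq x by rewrite mulr_ge0 ?sqr_ge0 ?nsq_ge0.
have -> : (1 - t / 2) ^+ 2 * nsq x = nsq x - t * nsq x + t ^+ 2 * nsq x / 4 by field.
rewrite e1 in h1; rewrite e2 in h2.
by lra.
Qed.

(** A member of the lattice that contains u contains the range, and one that is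
    orthogonal to v is in the kernel. *)
Lemma rank_one_in u v :
  (forall S, L S -> S u \/ forall s, S s -> inner s v = 0) ->
  exists a, a = rank_one u v :> (H -> H).
Proof.
move=> h; apply: cA_intro; [exact: rank_one_bounded|exact: rank_one_compact|].
move=> S LS x Sx; rewrite /rank_one; have cS := sl_closed LS.
by have [Su|h0] := h S LS; [exact: subspaceZ|rewrite h0// scale0r; case: cS].
Qed.

End Coercive.

(** * Positive forms and commuting projections *)

Section PositiveForms.
Context {R : realType} {H : hilbertType R}.
Implicit Types (x y u v : H) (g h E F G : H -> H).

Definition selfadjoint G := forall x y, inner (G x) y = inner x (G y).

Lemma discriminant_le (A B r : R) : 0 <= B ->
  (forall t, 0 <= A - 2 * t * r + t ^+ 2 * B) -> r ^+ 2 <= A * B.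
Proof.
move=> B0 h; have [B00|B1] := eqVneq B 0.
  have [->|r0] := eqVneq r 0; first by rewrite expr0n B00 mulr0.
  have := h ((A + 1) / (2 * r)); rewrite B00 mulr0 addr0.
  have -> : A - 2 * ((A + 1) / (2 * r)) * r = - 1 by field.
  by lra.
have pB : 0 < B by rewrite lt_neqAle eq_sym B1.
have := h (r / B).
have -> : A - 2 * (r / B) * r + (r / B) ^+ 2 * B = (A * B - r ^+ 2) / B by field.
by rewrite pmulr_lge0 ?invr_gt0// subr_ge0.
Qed.

Lemma rip_sa G x y : selfadjoint G -> rip (G x) y = rip x (G y).
Proof. by move=> sG; rewrite /rip sG. Qed.

Lemma inner_sa_real G x : selfadjoint G -> inner (G x) x = (rip (G x) x)%:C%C.
Proof.
move=> sG; rewrite /rip; have := sG x x; rewrite [RHS]innerC.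
by case: (inner _ _) => p q /= [q0]; congr (_ +i* _)%C; lra.
Qed.

Section CauchySchwarz.
Variable G : H -> H.
Hypotheses (lG : linear G) (sG : selfadjoint G) (pG : forall x, 0 <= rip (G x) x).

Lemma form_CS_real x v : rip (G x) v ^+ 2 <= rip (G x) x * rip (G v) v.
Proof.
apply: discriminant_le => // t.
have := pG (x - t%:C%C *: v); rewrite (linB lG) (linZ lG) !ripE.
by rewrite (rip_sa v x sG) (ripC v (G x)); lra.
Qed.

(** The real Cauchy-Schwarz inequality for x and a multiple of v by a complex number that
    makes the form real. *)
Lemma form_CS x v :
  complex.Re (inner (G x) v) ^+ 2 + complex.Im (inner (G x) v) ^+ 2 <=
  rip (G x) x * rip (G v) v.
Proof.
set p := inner (G x) v.
have := form_CS_real x (p *: v).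
rewrite /rip (linZ lG) innerZr -/p innerZl innerZr -!/(rip _ _).
have -> : complex.Re (p^*%C * p) = complex.Re p ^+ 2 + complex.Im p ^+ 2.
  by case: p => a b /=; ring.
have -> : complex.Re (p * (p^*%C * inner (G v) v)) =
    (complex.Re p ^+ 2 + complex.Im p ^+ 2) * rip (G v) v.
  by rewrite /rip; case: p (inner (G v) v) => [a b] [c d] /=; ring.
set m := _ + _; set B := rip (G v) v; set C := rip _ _ => h.
have m0 : 0 <= m by rewrite addr_ge0// sqr_ge0.
have [->|m1] := eqVneq m 0; first by rewrite mulr_ge0 ?pG.
have pm : 0 < m by rewrite lt_neqAle eq_sym m1.
by rewrite -(ler_pM2l pm) -expr2 mulrCA.
Qed.

Lemma form_eq0 x : rip (G x) x = 0 -> G x = 0.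
Proof.
move=> h; have := form_CS_real x (G x); rewrite h mul0r => h1.
by apply: nsq_eq0; apply/eqP; rewrite -sqrf_eq0 eq_le h1 sqr_ge0.
Qed.

End CauchySchwarz.

Definition weight g := [/\ linear g, selfadjoint g, (forall x, 0 <= rip (g x) x) &
  forall x, rip (g x) x <= nsq x].

Definition ortho_proj E := [/\ linear E, selfadjoint E & forall x, E (E x) = E x].

Lemma weight_id : weight id.
Proof. by split=> // x; rewrite ?lexx ?nsq_ge0. Qed.

Section WeightStep.
Variables (g E : H -> H).
Hypotheses (wg : weight g) (pE : ortho_proj E) (gE : forall x, g (E x) = E (g x)).

Lemma weight_projE x : rip (g (E x)) x = rip (g (E x)) (E x).
Proof. by case: pE => _ sE EE; rewrite gE -{1}EE (rip_sa _ _ sE). Qed.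

Lemma weight_proj_ge0 x : 0 <= rip (g (E x)) x.
Proof. by rewrite weight_projE; case: wg. Qed.

Lemma weight_proj_linear : linear (fun x => g (E x)).
Proof. by case: wg pE => lg _ _ _ [lE _ _] k x y; rewrite lE lg. Qed.

Lemma weight_proj_sa : selfadjoint (fun x => g (E x)).
Proof. by case: wg pE => _ sg _ _ [_ sE _] x y; rewrite gE sE sg. Qed.

Definition shrink (s : R) x := g x - s%:C%C *: g (E x).

Lemma shrink_form (s : R) x : rip (shrink s x) x = rip (g x) x - s * rip (g (E x)) x.
Proof. by rewrite /shrink !ripE. Qed.

Lemma shrink_weight (s : R) : 0 <= s -> s <= 1 -> weight (shrink s).
Proof.
move=> s0 s1; have [lg sg g0 g1] := wg; have [lE sE EE] := pE.
split.
- move=> k x y; rewrite /shrink lE !lg scalerDr opprD addrACA.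
  by rewrite scalerBr !scalerA mulrC.
- move=> x y; rewrite /shrink innerBl innerBr innerZl innerZr sg weight_proj_sa.
  by congr (_ - _ * _); apply/eqP; rewrite eq_complex /= oppr0 !eqxx.
- move=> x; rewrite shrink_form.
  have h1 := weight_proj_ge0 x; have := g0 (x - E x).
  rewrite (linB lg) !ripE -weight_projE (rip_sa x (E x) sg) (ripC x (g (E x))).
  have h2 : s * rip (g (E x)) x <= rip (g (E x)) x by rewrite ler_piMl.
  by lra.
- move=> x; rewrite shrink_form; have := weight_proj_ge0 x; have := g1 x => h1 h2.
  by rewrite lerBlDr (le_trans h1)// lerDl mulr_ge0.
Qed.

End WeightStep.

End PositiveForms.

(** * The greedy transport step *)

Section Greedy.
Context {R : realType} {H : hilbertType R}.
Variable L : subspace_lattice H.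
Local Notation A := (compact_Alg L).
Implicit Types (a b : A) (x y u v w : H) (g h E F : H -> H) (S T : set H).

Lemma ortho_proj_proj S : closed_subspace S -> ortho_proj (proj S).
Proof.
by move=> cS; split; [exact: proj_linear|move=> x y; exact: proj_sa|exact: projK].
Qed.

Lemma ortho_proj_compl E : ortho_proj E -> ortho_proj (fun x => x - E x).
Proof.
move=> [lE sE EE]; split=> [k x y|x y|x].
- by rewrite lE scalerBr opprD addrACA.
- by rewrite innerBl innerBr sE.
- by rewrite (linB lE) EE subrr subr0.
Qed.

Definition commutes g := forall S, L S -> forall x, g (proj S x) = proj S (g x).

(** Arithmetic and geometric means with the weights al / be and be / al. *)
Lemma two_Re_mul_le (p r : R[i]) (al be A' B : R) : 0 < al -> 0 < be ->
  complex.Re p ^+ 2 + complex.Im p ^+ 2 <= be * B ->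
  complex.Re r ^+ 2 + complex.Im r ^+ 2 <= al * A' ->
  2 * complex.Re (p * r) <= al * B + be * A'.
Proof.
case: p r => [p1 p2] [r1 r2] /= al0 be0 hp hr.
have h1 : 0 <= (al * p1 - be * r1) ^+ 2 + (al * p2 + be * r2) ^+ 2.
  by rewrite addr_ge0 ?sqr_ge0.
have h2 : al ^+ 2 * (p1 ^+ 2 + p2 ^+ 2) <= al ^+ 2 * (be * B).
  by rewrite ler_wpM2l// sqr_ge0.
have h3 : be ^+ 2 * (r1 ^+ 2 + r2 ^+ 2) <= be ^+ 2 * (al * A').
  by rewrite ler_wpM2l// sqr_ge0.
rewrite -(ler_pM2l (mulr_gt0 al0 be0)).
by nra.
Qed.

(** The last inequality is the Schur test for a in telescoped form: each step consumes
    what the weights lose at v and at u. *)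
Definition greedy_state x g h a := [/\ weight g, weight h, commutes g, commutes h &
  [/\ rip (g x) x = rip (h x) x, a x = x - g x &
      forall u v, 2 * rip (a u) v <=
        (nsq u - rip (h u) u) + (nsq v - rip (g v) v)]].

(** The rank-one operator with range spanned by g E x and kernel the orthogonal
    complement of h F x is scaled by a factor th, so that it maps x to
    s g E x.  The mass th al be lost by g is that lost by h, and th is the smaller of
    1 / al and 1 / be. *)
Lemma greedy_step x g h a E F : greedy_state x g h a ->
  ortho_proj E -> ortho_proj F -> commutes E -> commutes F ->
  (forall y, g (E y) = E (g y)) -> (forall y, h (F y) = F (h y)) ->
  (forall w w', exists b, b = rank_one (E w) (F w') :> (H -> H)) ->
  exists s t a', [/\ 0 <= s, 0 <= t, s = 1 \/ t = 1 &
    greedy_state x (shrink g E s) (shrink h F t) a'].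
Proof.
move=> [wg wh cg ch [ghx ax bnda]] pE pF cE cF gE hF ro.
pose al := rip (g (E x)) x; pose be := rip (h (F x)) x.
have gE0 y : 0 <= rip (g (E y)) y by exact: (weight_proj_ge0 wg pE gE).
have hF0 y : 0 <= rip (h (F y)) y by exact: (weight_proj_ge0 wh pF hF).
have gEl := weight_proj_linear wg pE; have gEs := weight_proj_sa wg pE gE.
have hFl := weight_proj_linear wh pF; have hFs := weight_proj_sa wh pF hF.
have al0 : 0 <= al by exact: gE0.
have be0 : 0 <= be by exact: hF0.
have [b hb] := ro (g x) (h x).
have key s t th : 0 <= s -> s <= 1 -> 0 <= t -> t <= 1 -> s * al = t * be ->
    th%:C%C *: b x = s%:C%C *: g (E x) ->
    (forall u v, 2 * (th * rip (b u) v) <= t * rip (h (F u)) u + s * rip (g (E v)) v) ->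
    greedy_state x (shrink g E s) (shrink h F t) (a + th%:C%C *: b).
  move=> s0 s1 t0 t1 st bx bb.
  have cs g' E' : commutes g' -> commutes E' -> linear g' ->
      forall r : R, commutes (shrink g' E' r).
    move=> cg' cE' lg' r S LS y; have [lP _ _] := ortho_proj_proj (sl_closed LS).
    by rewrite /shrink (linB lP) (linZ lP) cE'// !cg'.
  split.
  - exact: shrink_weight.
  - exact: shrink_weight.
  - by apply: cs => //; case: wg.
  - by apply: cs => //; case: wh.
  split.
  - by rewrite !shrink_form ghx -/al -/be st.
  - by rewrite cA_addE cA_scaleE ax bx /shrink opprD opprK addrA.
  - move=> u v; rewrite cA_addE cA_scaleE !shrink_form ripDl ripZl.
    by have := bnda u v; have := bb u v; lra.
have be_b u v : rip (b u) v = complex.Re (inner u (h (F x)) * inner (g (E x)) v).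
  by rewrite hb /rank_one /rip innerZl gE hF.
(* A zero mass means that g E x = 0, so that s = 1 costs nothing. *)
have [al00|al1] := eqVneq al 0.
  exists 1, 0, (a + 0%:C%C *: b); split=> //; first by left.
  apply: key => //; first by rewrite al00 mulr0 mul0r.
    have -> : g (E x) = 0 := form_eq0 gEl gEs gE0 al00.
    by rewrite scaler0 scale0r.
  by move=> u v; rewrite !mul0r mulr0 add0r mul1r.
have [be00|be1] := eqVneq be 0.
  exists 0, 1, (a + 0%:C%C *: b); split=> //; first by right.
  apply: key => //; first by rewrite be00 mulr0 mul0r.
    by rewrite !scale0r.
  by move=> u v; rewrite !mul0r mulr0 addr0 mul1r.
have pal : 0 < al by rewrite lt_neqAle eq_sym al1.
have pbe : 0 < be by rewrite lt_neqAle eq_sym be1.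
have main th : 0 <= th -> th * be <= 1 -> th * al <= 1 ->
    greedy_state x (shrink g E (th * be)) (shrink h F (th * al)) (a + th%:C%C *: b).
  move=> th0 h1 h2; apply: key => //; rewrite ?mulr_ge0//.
  - by rewrite mulrAC.
  - rewrite hb /rank_one -hF -gE scalerA; congr (_ *: _).
    rewrite rmorphM/=; congr (_ * _).
    by have := inner_sa_real x hFs; rewrite (hFs x x).
  - move=> u v; rewrite be_b mulrCA.
    rewrite -[leRHS](_ : th * (al * rip (h (F u)) u + be * rip (g (E v)) v) = _); last by ring.
    rewrite ler_wpM2l//; apply: two_Re_mul_le => //.
      have := form_CS hFl hFs hF0 x u; rewrite innerC.
      by case: (inner _ _) => p q /=; rewrite sqrrN.
    exact: (form_CS gEl gEs gE0 x v).
have [ab|ba] := leP al be.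
  exists (be^-1 * be), (be^-1 * al), (a + (be^-1)%:C%C *: b); split.
  - by rewrite mulVf.
  - by rewrite mulr_ge0 ?invr_ge0.
  - by left; rewrite mulVf.
  - apply: main; rewrite ?invr_ge0 ?mulVf// mulrC ler_pdivrMr// mul1r//.
exists (al^-1 * be), (al^-1 * al), (a + (al^-1)%:C%C *: b); split.
- by rewrite mulr_ge0 ?invr_ge0.
- by rewrite mulVf.
- by right; rewrite mulVf.
- by apply: main; rewrite ?invr_ge0 ?mulVf// mulrC ler_pdivrMr// mul1r ltW.
Qed.

End Greedy.

(** * Completely distributive commutative lattices *)

Section ClosedSpan.
Context {R : realType} {H : hilbertType R}.
Implicit Types (A S : set H) (x y : H).

Lemma sub_linear_span A : A `<=` linear_span A.
Proof.
move=> x Ax; exists 1%N, (fun=> 1), (fun=> x); split=> //.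
by rewrite big_ord1 scale1r.
Qed.

Lemma linear_span_lin A (k : R[i]) x y :
  linear_span A x -> linear_span A y -> linear_span A (k *: x + y).
Proof.
move=> [n [c [f [Af ->]]]] [m [d [f' [Af' ->]]]].
exists (n + m)%N,
  (fun i => match fintype.split i with inl i => k * c i | inr i => d i end),
  (fun i => match fintype.split i with inl i => f i | inr i => f' i end); split.
  by move=> i; case: (fintype.split i).
rewrite big_split_ord/= scaler_sumr; congr (_ + _); apply: eq_bigr => i _.
  by rewrite (unsplitK (inl i)) scalerA.
by rewrite (unsplitK (inr i)).
Qed.

Lemma linear_span_sub A (S : set H) : S 0 ->
  (forall (k : R[i]) x y, S x -> S y -> S (k *: x + y)) ->
  A `<=` S -> linear_span A `<=` S.
Proof.
move=> S0 lS AS _ [n [c [f [Af ->]]]].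
elim/big_rec: _ => // i x _ Sx; apply: lS => //; exact: AS.
Qed.

Lemma sub_closed_span A : A `<=` closed_span A.
Proof. by move=> x Ax; apply: subset_closure; exact: sub_linear_span. Qed.

Lemma closed_span_sub A S : closed_subspace S -> A `<=` S -> closed_span A `<=` S.
Proof.
move=> [S0 lS clS] AS x Ax; rewrite (closure_id S).1//.
by apply: closureS Ax; exact: linear_span_sub.
Qed.

Lemma closed_span_closed_subspace A : closed_subspace (closed_span A).
Proof.
split; last exact: closed_closure.
- apply: subset_closure; exists 0%N, (fun=> 0), (fun=> 0).
  by split=> [[]//|]; rewrite big_ord0.
- move=> k x y /closureP hx /closureP hy; apply/closureP => e e0.
  have Rk : 0 <= complex.Re `|k| by rewrite -ler0c RRe_real ?normr_real.
  pose K := complex.Re `|k| + 1; have K0 : 0 < K by rewrite ltr_wpDl.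
  have e2 : 0 < e / 2 by rewrite divr_gt0.
  have [x' Ax' xx'] := hx _ (divr_gt0 e2 K0); have [y' Ay' yy'] := hy _ e2.
  exists (k *: x' + y'); first exact: linear_span_lin.
  rewrite opprD addrACA -scalerBr (splitr e).
  apply: le_lt_trans (nr_triangle _ _) _; rewrite ler_ltD// nrZc.
  rewrite ltr_pdivlMr// in xx'; apply: le_trans (ltW xx').
  by rewrite mulrC ler_wpM2l ?nr_ge0// lerDl.
Qed.

End ClosedSpan.

Section Distributive.
Context {R : realType} {H : hilbertType R}.
Variable L : subspace_lattice H.
Local Notation A := (compact_Alg L).
Implicit Types (a b : A) (x y u v w : H) (g h E F : H -> H) (S T Q : set H).

(** The predecessor S_- of S. *)
Definition lower S : set H := closed_span (\bigcup_(T in [set T | L T /\ ~ S `<=` T]) T).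

Lemma lower_mem S : L (lower S).
Proof. by apply: sl_join => T []. Qed.

(** Distribute the intersection over S of the joins defining [lower S] over the choice
    functions f.  If the intersection W of the members chosen by f were not contained in
    Q, then W would be one of the S, and f W would not contain W although W is included
    in all the members chosen by f. *)
Lemma completely_distributive_lower Q v : completely_distributive L -> L Q ->
  (forall S, L S -> ~ S `<=` Q -> lower S v) -> Q v.
Proof.
move=> cd LQ hv.
pose I := {S : set H | L S /\ ~ S `<=` Q}.
pose J (i : I) := {T : set H | L T /\ ~ sval i `<=` T}.
have [|e _] := cd I J (fun i j => sval j); first by move=> i [T []].
have : (\bigcap_i closed_span (\bigcup_(j : J i) sval j)) v.
  move=> [S [LS SQ]] _; have := hv S LS SQ; rewrite /lower.
  apply: closureS; apply: linear_span_sub.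
  - exists 0%N, (fun=> 0), (fun=> 0).
    by split=> [[]//|]; rewrite big_ord0.
  - by move=> k x y; exact: linear_span_lin.
  - move=> x [T [LT ST] Tx]; apply: sub_linear_span.
    by exists (exist _ T (conj LT ST)).
rewrite e; apply: closed_span_sub; first exact: (sl_closed LQ).
move=> x [f _ fx]; apply: contrapT => nQx.
pose W := \bigcap_(S in [set sval (f i) | i in [set: I]]) S.
have LW : L W by apply: sl_meet => _ [i _ <-]; case: (f i) => T [].
have Wx : W x by move=> _ [i _ <-]; exact: fx.
have WQ : ~ W `<=` Q by move=> /(_ x Wx).
have [_] := svalP (f (exist _ W (conj LW WQ))); apply => y Wy.
by apply: Wy; exists (exist _ W (conj LW WQ)).
Qed.

Hypothesis cL : commutative_lattice L.

Lemma commutes_proj S : L S -> commutes L (proj S).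
Proof.
move=> LS T LT x.
exact: (congr1 (fun f => f x) (cL LS LT (projP (sl_closed LS)) (projP (sl_closed LT)))).
Qed.

(** The projection on the orthogonal complement of S_-. *)
Definition upper S x := x - proj (lower S) x.

Lemma commutes_upper S : commutes L (upper S).
Proof.
move=> T LT x; have lT := proj_linear (sl_closed LT).
by rewrite /upper (linB lT) (commutes_proj (lower_mem S)).
Qed.

Lemma rank_one_lower_in S w w' : L S ->
  exists b, b = rank_one (proj S w) (upper S w') :> (H -> H).
Proof.
move=> LS; apply: rank_one_in => T LT.
have [ST|ST] := pselect (S `<=` T).
  by left; apply: ST; exact: (proj_in (sl_closed LS)).
right=> s Ts; rewrite innerC (proj_orth (sl_closed (lower_mem S))) ?rmorph0//.
by apply: sub_closed_span; exists T.
Qed.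

Definition exhausted g h S := (forall y, g (proj S y) = 0) \/ (forall y, h (upper S y) = 0).

Fixpoint all_exhausted g h (l : seq (set H)) : Prop :=
  if l is X :: l' then (L X -> exhausted g h X) /\ all_exhausted g h l' else True.

Lemma all_exhausted_cat g h l l' :
  all_exhausted g h (l ++ l') <-> all_exhausted g h l /\ all_exhausted g h l'.
Proof. by elim: l => [|S l IH] /=; [split=> // -[]|rewrite IH; split=> [[? []]|[[]]]]. Qed.

Lemma greedy_exists x l : exists g h a, greedy_state x g h a /\ all_exhausted g h l.
Proof.
elim: l => [|S l [g [h [a [gd kl]]]]].
  exists id, id, 0; split=> //; split=> //; [exact: weight_id|exact: weight_id|].
  split=> // [|u v]; first by rewrite subrr.
  by rewrite cA_0E rip0l mulr0 /nsq !subrr addr0.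
have [LS|nLS] := pselect (L S); last by exists g, h, a.
have [wg wh cg ch _] := gd.
have pE := ortho_proj_proj (sl_closed LS).
have pF : ortho_proj (upper S) := ortho_proj_compl (ortho_proj_proj (sl_closed (lower_mem S))).
have gE := cg _ LS.
have hF y : h (upper S y) = upper S (h y).
  by rewrite /upper (linB (let: And4 l _ _ _ := wh in l)) ch//; exact: lower_mem.
have [s [t [a' [s0 t0 st gd']]]] := greedy_step gd pE pF (commutes_proj LS)
  (commutes_upper S) gE hF (fun w w' => rank_one_lower_in w w' LS).
exists (shrink g (proj S) s), (shrink h (upper S) t), a'; split=> //=; split.
  have [_ _ EE] := pE; have [_ _ FF] := pF; move=> _.
  case: st => st; [left|right] => y; rewrite /shrink st scale1r.
    by rewrite EE subrr.
  by rewrite FF subrr.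
elim: {gd' st} l kl => //= T l IH [kT kl]; split; last exact: IH.
move=> LT; have [k|k] := kT LT; [left|right] => y; rewrite /shrink k sub0r.
  by rewrite (commutes_proj LS LT) k scaler0 oppr0.
rewrite [X in X y]/upper (linB (let: And3 l _ _ := pF in l)).
by rewrite (commutes_upper S (lower_mem T)) k scaler0 oppr0.
Qed.

End Distributive.

Section DistributiveUnit.
Context {R : realType} {H : hilbertType R}.
Variable L : subspace_lattice H.
Local Notation A := (compact_Alg L).
Implicit Types (a b : A) (x y u v w p : H) (g h E F : H -> H) (S T Q : set H).

Hypotheses (cL : commutative_lattice L) (cdL : completely_distributive L).

(** Let r be the part of x - proj Q x that is orthogonal to all these ranges.
    It lies in S_- for all S outside I, in particular for all S not contained in Q, hence
    in Q; but it is also orthogonal to Q. *)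
Lemma complement_join_upper (I : set H -> Prop) Q x :
  Q = closed_span (\bigcup_(S in [set S | L S /\ I S]) S) ->
  closed_span (\bigcup_(S in [set S | L S /\ ~ I S]) range (upper L S))
    (x - proj Q x).
Proof.
move=> QE; have LQ : L Q by rewrite QE; apply: sl_join => S [].
set Z := closed_span _; have cZ : closed_subspace Z by exact: closed_span_closed_subspace.
have cQ := sl_closed LQ.
set y := x - proj Q x; pose r := y - proj Z y.
have Qr : Q r.
  apply: (completely_distributive_lower cdL LQ) => S LS SQ.
  have nIS : ~ I S.
    move=> IS; apply: SQ => z Sz; rewrite QE; apply: sub_closed_span; by exists S.
  have cl := sl_closed (lower_mem L S).
  suff : upper L S r = 0.
    by move/eqP; rewrite subr_eq0 => /eqP->; exact: proj_in.
  have pF : ortho_proj (upper L S) := ortho_proj_compl (ortho_proj_proj cl).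
  have [_ sF FF] := pF; apply: nsq_eq0.
  rewrite /nsq /rip -sF FF sF /r proj_orth//.
  by apply: sub_closed_span; exists S => //; exists (upper L S r).
suff r0 : r = 0 by move/eqP: r0; rewrite subr_eq0 => /eqP->; exact: proj_in.
apply: nsq_eq0; rewrite /nsq /rip {1}/r innerBl /y proj_orth// sub0r.
rewrite innerC -/y -/r [X in complex.Re (- X^*%C)]proj_orth ?rmorph0 ?oppr0//.
exact: proj_in.
Qed.

(** g does not see p, so it can be evaluated at x - p. *)
Lemma weight_le_dist g x p : weight g -> g p = 0 -> rip (g x) x <= nsq (x - p).
Proof.
move=> [lg sg _ g1] gp; apply: le_trans (g1 (x - p)).
by rewrite (linB lg) gp subr0 ripDr ripNr (rip_sa x p sg) gp rip0r oppr0 addr0.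
Qed.

(** An ultrafilter on the states that contains, for each finite sequence of members, the
    states having treated it, decides for every S in L whether g or h is exhausted on
    S.  Approximate proj Q x and x - proj Q x by finite sums p and p' of vectors on which
    g, respectively h, eventually vanishes. *)
Lemma distributive_coercive_unit : coercive_unit L.
Proof.
exists 1, 4^-1; split=> // x.
have [->|x0] := eqVneq x 0.
  exists 0; split=> [z|]; first by rewrite cA_0E nr0 mul1r nr_ge0.
  by rewrite nsq0 mulr0 cA_0E rip0l.
have nx0 : 0 < nr x.
  by rewrite lt_neqAle nr_ge0 andbT eq_sym; apply: contra_neq x0 => /nr_eq0.
pose St := ((H -> H) * (H -> H) * A)%type.
pose K (l : seq (set H)) :=
  [set s : St | greedy_state x s.1.1 s.1.2 s.2 /\ all_exhausted L s.1.1 s.1.2 l].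
have FF : ProperFilter (filter_from setT K).
  apply: filter_from_proper; last first.
    move=> l _; have [g [h [a [gd kl]]]] := greedy_exists cL x l.
    by exists (g, h, a).
  apply: filter_from_filter; first by exists [::].
  move=> l l' _ _; exists (l ++ l') => // s [gd] /all_exhausted_cat[kl kl'].
  by split; split.
have [U [UU FU]] := ultraFilterLemma FF.
have UF : Filter U := @ultra_proper _ U UU.
have Ugood : U [set s : St | greedy_state x s.1.1 s.1.2 s.2].
  by apply: FU; exists [::] => // s [].
pose I S := U [set s : St | forall y, s.1.1 (proj S y) = 0].
have UnI S : L S -> ~ I S -> U [set s : St | forall y, s.1.2 (upper L S y) = 0].
  move=> LS nI.
  have [//|Uc] :=
    in_ultra_setVsetC [set s : St | forall y, s.1.1 (proj S y) = 0] UU.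
  have UK : U (K [:: S]) by apply: FU; exists [:: S].
  apply: filterS2 Uc UK => s ns [_ [/(_ LS)[] //]].
pose Q := closed_span (\bigcup_(S in [set S | L S /\ I S]) S).
have LQ : L Q by apply: sl_join => S [].
have gspan p : linear_span (\bigcup_(S in [set S | L S /\ I S]) S) p ->
    U [set s : St | weight s.1.1 /\ s.1.1 p = 0].
  apply: (@linear_span_sub _ _ _ [set p | U [set s : St | weight s.1.1 /\ s.1.1 p = 0]]).
  - apply: filterS Ugood => s [wg _ _ _ _]; split=> //.
    by case: wg => lg _ _ _; exact: lin0.
  - move=> k y z; apply: filterS2 => s [wg gy] [_ gz]; split=> //.
    by case: wg => lg _ _ _; rewrite lg gy gz scaler0 addr0.
  - move=> y [S [LS IS] Sy]; apply: filterS2 Ugood IS => s [wg _ _ _ _] /(_ y).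
    by rewrite proj_id//; exact: sl_closed LS.
have hspan p : linear_span (\bigcup_(S in [set S | L S /\ ~ I S]) range (upper L S)) p ->
    U [set s : St | weight s.1.2 /\ s.1.2 p = 0].
  apply: (@linear_span_sub _ _ _ [set p | U [set s : St | weight s.1.2 /\ s.1.2 p = 0]]).
  - apply: filterS Ugood => s [_ wg _ _ _]; split=> //.
    by case: wg => lg _ _ _; exact: lin0.
  - move=> k y z; apply: filterS2 => s [wg gy] [_ gz]; split=> //.
    by case: wg => lg _ _ _; rewrite lg gy gz scaler0 addr0.
  - move=> y [S [LS nIS] [z _ <-]]; apply: filterS2 Ugood (UnI S LS nIS).
    by move=> s [_ wg _ _ _].
(* With errors of size e, twice the remaining mass is at most |x|^2 + 66 e ^ 2, where
   |x|^2 = 256 e ^ 2; this is less than 3/2 |x|^2. *)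
pose e := nr x / 16; have e0 : 0 < e by rewrite divr_gt0.
have /closureP /(_ e e0)[p /gspan Up xp] := @proj_in _ _ _ (sl_closed LQ) x.
have /closureP /(_ e e0)[p' /hspan Up' xp'] := @complement_join_upper I Q x erefl.
have [[[g h] a] /= [[gd [wg gp]] [wh hp']]] := filter_ex (filterI (filterI Ugood Up) Up').
exists a; have [_ _ _ _ [ghx ax bnda]] := gd; split.
  apply: bounded_by_form => // u v; apply: le_trans (bnda u v) _.
  have [_ _ g0 _] := wg; have [_ _ h0 _] := wh.
  by have := g0 v; have := h0 u; lra.
have h1 := weight_le_dist x wg gp; have h2 := weight_le_dist x wh hp'.
have hn := nsq_proj (sl_closed LQ) x; rewrite -!nr_sqr in h1 h2 hn.
rewrite ax ripDl ripNl -/(nsq x) -nr_sqr.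
set al := nr (x - proj Q x) in xp' hn *; set be := nr (proj Q x) in xp hn *.
have q1 : nr (x - p) <= al + e.
  rewrite -(subrKA (proj Q x)); apply: le_trans (nr_triangle _ _) _.
  by rewrite lerD2l ltW.
have q2 : nr (x - p') <= be + e.
  rewrite -[x in nr (x - _)](subrK (proj Q x)) addrAC addrC.
  by apply: le_trans (nr_triangle _ _) _; rewrite lerD2l ltW.
have al0 : 0 <= al := nr_ge0 _; have be0 : 0 <= be := nr_ge0 _.
have q1' : nr (x - p) ^+ 2 <= (al + e) ^+ 2.
  by rewrite ler_pXn2r// nnegrE ?nr_ge0// addr_ge0// ltW.
have q2' : nr (x - p') ^+ 2 <= (be + e) ^+ 2.
  by rewrite ler_pXn2r// nnegrE ?nr_ge0// addr_ge0// ltW.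
have ex : nr x = 16 * e by rewrite /e; field.
have al1 : al <= nr x.
  rewrite -(@ler_pXn2r _ 2) ?nnegrE ?nr_ge0//.
  by have := sqr_ge0 be; lra.
have be1 : be <= nr x.
  rewrite -(@ler_pXn2r _ 2) ?nnegrE ?nr_ge0//.
  by have := sqr_ge0 al; lra.
have r1 : e * al <= e * nr x by rewrite ler_wpM2l// ltW.
have r2 : e * be <= e * nr x by rewrite ler_wpM2l// ltW.
rewrite ghx in h1 *.
rewrite ex in r1 r2 hn *.
by have := sqr_ge0 e; lra.
Qed.

End DistributiveUnit.

(** * Finite differences of real sequences *)

Section Differences.
Context {R : realType}.
Implicit Types (f : nat -> R) (n m k N M : nat).

Definition fdiff f n := f n - f n.+1.

(** Summations by parts.  For f n = b ^ n the left-hand sides for the differences of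
    order k = 2, 3, 4 are, up to (k - 1)!, the product of (1 - b) ^ k with partial sums
    of the binomial series of (1 - b) ^ (- k). *)
Lemma sum_fdiff2 f N : \sum_(n < N) n.+1%:R * fdiff (fdiff f) n =
  f 0%N - f N - N%:R * fdiff f N.
Proof.
elim: N => [|N IH]; first by rewrite big_ord0 mul0r subr0 subrr.
rewrite big_ord_recr/= IH /fdiff -natr1; ring.
Qed.

Lemma sum_fdiff3 f N : \sum_(n < N) (n.+1%:R * n.+2%:R) * fdiff (fdiff (fdiff f)) n =
  2 * f 0%N - 2 * f N - 2 * N%:R * fdiff f N - N%:R * (N%:R + 1) * fdiff (fdiff f) N.
Proof.
elim: N => [|N IH]; first by rewrite big_ord0; ring.
by rewrite big_ord_recr/= IH /fdiff -!natr1; ring.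
Qed.

Lemma sum_fdiff4 f N :
  \sum_(n < N) (n.+1%:R * n.+2%:R * n.+3%:R) * fdiff (fdiff (fdiff (fdiff f))) n =
  6 * f 0%N - 6 * f N - 6 * N%:R * fdiff f N - 3 * N%:R * (N%:R + 1) * fdiff (fdiff f) N
  - N%:R * (N%:R + 1) * (N%:R + 2) * fdiff (fdiff (fdiff f)) N.
Proof.
elim: N => [|N IH]; first by rewrite big_ord0; ring.
by rewrite big_ord_recr/= IH /fdiff -!natr1; ring.
Qed.

(** The differences decrease and k of them add up to at most f m. *)
Lemma fdiff_decay f : (forall n, 0 <= f n) -> (forall n, 0 <= fdiff (fdiff f) n) ->
  forall m k, k%:R * fdiff f (m + k) <= f m.
Proof.
move=> f0 f2 m k; suff h : k%:R * fdiff f (m + k) <= f m - f (m + k)%N.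
  by apply: le_trans h _; rewrite gerBl.
elim: k => [|k IH]; first by rewrite mul0r addn0 subrr.
have h := f2 (m + k)%N; rewrite addnS; have k0 : 0 <= k%:R :> R by [].
have h1 : fdiff f (m + k).+1 <= fdiff f (m + k) by move: h; rewrite {1}/fdiff subr_ge0.
have h2 := ler_wpM2l k0 h1.
have h3 : f (m + k).+1 = f (m + k)%N - fdiff f (m + k) by rewrite /fdiff; ring.
by rewrite h3 -natr1 mulrDl mul1r; lra.
Qed.

End Differences.

(** * Projections of finite rank *)

Section FiniteRankProjections.
Context {R : realType} {H : hilbertType R}.
Implicit Types (x y u v w : H) (E : H -> H).

Lemma ortho_proj_contr E x : ortho_proj E -> nr (E x) <= nr x.
Proof.
move=> [_ sE EE]; have h : nr (E x) ^+ 2 <= nr (E x) * nr x.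
  by rewrite nr_sqr /nsq -(rip_sa _ _ sE) EE rip_le.
have [->|n0] := eqVneq (nr (E x)) 0; first exact: nr_ge0.
by move: h; rewrite expr2 ler_pM2l// lt_neqAle eq_sym n0 nr_ge0.
Qed.

(** Gram-Schmidt. *)
Lemma finite_rank_projection (vs : seq H) : exists E (ws : seq H),
  [/\ ortho_proj E, (forall v, v \in vs -> E v = v) &
      forall u, E u = \sum_(w <- ws) inner u w *: w].
Proof.
elim: vs => [|v vs [E [ws [pE fE sE]]]].
  exists (fun=> 0), [::]; split=> // [|u]; last by rewrite big_nil.
  by split=> // [k x y|x y]; rewrite ?scaler0 ?addr0// inner0l inner0r.
have [lE aE EE] := pE.
pose w := v - E v; have [w0|w0] := eqVneq w 0.
  exists E, ws; split=> // z; rewrite inE => /orP[/eqP->|/fE//].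
  by apply/eqP; rewrite eq_sym -subr_eq0; apply/eqP.
have nw : 0 < nr w.
  by rewrite lt_neqAle nr_ge0 andbT eq_sym; apply: contra_neq w0 => /nr_eq0.
pose w' := (nr w)^-1%:C%C *: w.
have Ew' : E w' = 0 by rewrite (linZ lE) (linB lE) EE subrr scaler0.
have Ew'o u : inner (E u) w' = 0 by rewrite aE Ew' inner0r.
have w'1 : inner w' w' = 1.
  rewrite inner_self nsqZ -nr_sqr -exprMn mulVf ?expr1n// gt_eqF//.
have ww' : inner v w' *: w' = w.
  have -> : v = E v + w by rewrite addrC subrK.
  rewrite innerDl Ew'o add0r {1}(_ : w = (nr w)%:C%C *: w'); last first.
    by rewrite scalerA -rmorphM/= mulfV ?scale1r// gt_eqF.
  rewrite innerZl w'1 mulr1 scalerA -rmorphM/= mulfV ?scale1r// gt_eqF//.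
clearbody w'; exists (fun u => E u + inner u w' *: w'), (w' :: ws); split.
- split=> [k x y|x y|x].
  + by rewrite lE innerDl innerZl scalerDl scalerDr -scalerA addrACA.
  + by rewrite innerDl innerDr aE innerZl innerZr -innerC mulrC.
  + by rewrite (linD lE) (linZ lE) Ew' scaler0 addr0 EE innerDl Ew'o add0r innerZl w'1 mulr1.
- move=> z; rewrite inE => /orP[/eqP->|/fE Ez].
    by rewrite ww' addrC subrK.
  by rewrite Ez -{2}Ez Ew'o scale0r addr0.
- by move=> u; rewrite big_cons sE addrC.
Qed.

End FiniteRankProjections.

(** * Pairs of projections *)

Section TwoProjections.
Context {R : realType} {H : hilbertType R}.
Implicit Types (x y z u v w : H) (E : H -> H).

Variables P Q : H -> H.
Hypotheses (pP : ortho_proj P) (pQ : ortho_proj Q).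

Let lP : linear P. Proof. by case: pP. Qed.
Let lQ : linear Q. Proof. by case: pQ. Qed.
Let sP : selfadjoint P. Proof. by case: pP. Qed.
Let sQ : selfadjoint Q. Proof. by case: pQ. Qed.
Let PP x : P (P x) = P x. Proof. by case: pP. Qed.
Let QQ x : Q (Q x) = Q x. Proof. by case: pQ. Qed.

Variables D S : H -> H.
Hypotheses (DE : forall x, D x = P x - Q x) (SE : forall x, S x = P x + Q x - x).
Local Notation c x := (S (S x)).
Local Notation K x := (D (D x)).
Local Notation Sp x := (x + S x).
Local Notation Sm x := (x - S x).

Lemma diff_linear : linear D.
Proof. by move=> k x y; rewrite !DE lP lQ scalerBr opprD addrACA. Qed.
Lemma sum_linear : linear S.
Proof.
move=> k x y; rewrite !SE lP lQ; apply: inner_inj => z.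
by rewrite !(innerDl, innerNl, innerZl); ring.
Qed.
Local Notation lD := diff_linear.
Local Notation lS := sum_linear.

Lemma diff_sa : selfadjoint D.
Proof. by move=> x y; rewrite !DE innerBl innerBr sP sQ. Qed.
Lemma sum_sa : selfadjoint S.
Proof. by move=> x y; rewrite !SE innerBl innerBr innerDl innerDr sP sQ. Qed.

Lemma sum_P x : S (P x) = Q (P x).
Proof. by rewrite SE PP addrAC subrr add0r. Qed.
Lemma sum_Q x : S (Q x) = P (Q x).
Proof. by rewrite SE QQ addrK. Qed.
Lemma P_sum x : P (S x) = P (Q x).
Proof. by rewrite SE (linB lP) (linD lP) PP addrAC subrr add0r. Qed.
Lemma Q_sum x : Q (S x) = Q (P x).
Proof. by rewrite SE (linB lQ) (linD lQ) QQ addrK. Qed.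

Lemma sum_diff x : S (D x) = - D (S x).
Proof. by rewrite !DE (linB lS) sum_P sum_Q P_sum Q_sum opprB. Qed.

Lemma sum2_P x : c (P x) = P (c x).
Proof. by rewrite sum_P sum_Q !P_sum Q_sum. Qed.
Lemma sum2_Q x : c (Q x) = Q (c x).
Proof. by rewrite sum_Q sum_P !Q_sum P_sum. Qed.
Lemma diff2 x : K x = x - c x.
Proof.
have -> : c x = P (Q x) + Q (P x) - S x by rewrite SE P_sum Q_sum.
rewrite !DE (linB lP) (linB lQ) PP QQ SE.
by apply: rip_inj => z; rewrite !ripE; ring.
Qed.

Lemma nsq_sum_diff x : nsq x = nsq (S x) + nsq (D x).
Proof.
rewrite /nsq -(rip_sa _ _ sum_sa) -(rip_sa _ _ diff_sa) -ripDl diff2 addrC subrK//.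
Qed.

Lemma nr_sum x : nr (S x) <= nr x.
Proof. by rewrite nr_ler (nsq_sum_diff x) lerDl nsq_ge0. Qed.
Lemma nr_Sp x : nr (Sp x) <= 2 * nr x.
Proof. by apply: le_trans (nr_triangle _ _) _; have := nr_sum x; lra. Qed.
Lemma nr_Sm x : nr (Sm x) <= 2 * nr x.
Proof. by apply: le_trans (nr_triangle _ _) _; rewrite nrN; have := nr_sum x; lra. Qed.

(** If S were a symmetry this would be, up to a factor 4, the diagonal part of E with
    respect to S.  Removing the off-diagonal part is what makes [two_atom_op] of the size
    of D ^ 2 rather than D. *)
Definition block_op E x := Sp (E (Sp x)) + Sm (E (Sm x)).

(** This leaves the ranges M of P and N of Q invariant: the first term maps H into M and
    N to 0, the second one maps H into N and M to 0. *)
Definition two_atom_op E x := P (block_op E (x - Q x)) + Q (block_op E (x - P x)).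

Section Form.
Variable E : H -> H.
Hypothesis (pE : ortho_proj E).
Let lE : linear E. Proof. by case: pE. Qed.

Lemma block_op_linear : linear (block_op E).
Proof.
move=> k x y; rewrite /block_op.
have lp : linear (fun x => Sp x).
  move=> k' x' y'; rewrite lS; apply: inner_inj => z.
  by rewrite !(innerDl, innerNl, innerZl); ring.
have lm : linear (fun x => Sm x).
  move=> k' x' y'; rewrite lS; apply: inner_inj => z.
  by rewrite !(innerDl, innerNl, innerZl); ring.
rewrite (lp k x y) (lm k x y) !lE (lp k (E (Sp x))) (lm k (E (Sm x))).
by apply: inner_inj => z; rewrite !(innerDl, innerNl, innerZl); ring.
Qed.

Lemma block_op_form x y : rip (block_op E x) y =
  rip (E (Sp x)) (Sp y) + rip (E (Sm x)) (Sm y).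
Proof. by rewrite /block_op !ripE !(rip_sa _ y sum_sa). Qed.

(** From P = (1 + S + D) / 2 and Q = (1 + S - D) / 2 one finds
    2 P X (1 - Q) + 2 Q X (1 - P) = (1 + S) X (1 - S) + D X D, and
    (1 + S) (1 - S) = D ^ 2.  Each term on the right-hand side contains D twice. *)
Lemma two_atom_op_form u v : 2 * rip (two_atom_op E u) v =
  rip (E (K u)) (Sp (Sp v)) + rip (E (Sm (Sm u))) (K v) +
  (rip (E (Sp (D u))) (Sp (D v)) + rip (E (Sm (D u))) (Sm (D v))).
Proof.
have SpSm x : Sp (Sm x) = K x.
  by rewrite diff2 (linB lS); apply: rip_inj => z; rewrite !ripE; ring.
have SmSp x : Sm (Sp x) = K x.
  by rewrite diff2 (linD lS); apply: rip_inj => z; rewrite !ripE; ring.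
have e1 := block_op_form (Sm u) (Sp v); rewrite SpSm SmSp in e1.
rewrite -e1 -block_op_form /two_atom_op ripDl (rip_sa _ v sP) (rip_sa _ v sQ).
have lB := block_op_linear; move: (block_op E) lB => B lB {e1}.
have h x : (1 / 2)%:C%C *: (x + x) = x :> H.
  by apply: rip_inj => z; rewrite !ripE; field.
have -> : u - Q u = (1 / 2)%:C%C *: (Sm u + D u).
  by apply: rip_inj => z; rewrite SE DE !ripE; field.
have -> : u - P u = (1 / 2)%:C%C *: (Sm u - D u).
  by apply: rip_inj => z; rewrite SE DE !ripE; field.
have -> : P v = (1 / 2)%:C%C *: (Sp v + D v).
  by apply: rip_inj => z; rewrite SE DE !ripE; field.
have -> : Q v = (1 / 2)%:C%C *: (Sp v - D v).
  by apply: rip_inj => z; rewrite SE DE !ripE; field.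
move: (Sm u) (Sp v) (D u) (D v) => a b d e.
rewrite !(linZ lB) (linD lB) (linB lB).
by rewrite !ripE; field.
Qed.

Lemma proj_rip_le x y : rip (E x) y <= nr x * nr y.
Proof.
by apply: le_trans (rip_le _ _) _; rewrite ler_wpM2r ?nr_ge0// ortho_proj_contr.
Qed.

(** The parameter m balances the terms D ^ 2 u and u, and is meant to be of the order of
    the inverse of D ^ 2. *)
Definition energy (m : R) u := m * nsq (K u) + m^-1 * nsq u.

Lemma mul_le_weighted (m a b : R) : 0 < m -> 2 * (a * b) <= m * a ^+ 2 + m^-1 * b ^+ 2.
Proof.
move=> m0; rewrite -subr_ge0.
have -> : m * a ^+ 2 + m^-1 * b ^+ 2 - 2 * (a * b) = m^-1 * (m * a - b) ^+ 2.
  by field; rewrite gt_eqF.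
by rewrite mulr_ge0 ?sqr_ge0// invr_ge0 ltW.
Qed.

Lemma nsq_diff_energy (m : R) u : 0 < m -> 2 * nsq (D u) <= energy m u.
Proof.
move=> m0; rewrite {1}/nsq -(rip_sa _ _ diff_sa) /energy -!nr_sqr.
apply: le_trans (mul_le_weighted _ _ m0).
by rewrite ler_pM2l// rip_le.
Qed.

Lemma two_atom_op_bound (m : R) u v : 0 < m ->
  2 * rip (two_atom_op E u) v <= 4 * (energy m u + energy m v).
Proof.
move=> m0; rewrite two_atom_op_form.
have Sp2 x : nr (Sp (Sp x)) <= 4 * nr x.
  by apply: le_trans (nr_Sp _) _; have := nr_Sp x; lra.
have Sm2 x : nr (Sm (Sm x)) <= 4 * nr x.
  by apply: le_trans (nr_Sm _) _; have := nr_Sm x; lra.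
have h1 : rip (E (K u)) (Sp (Sp v)) <= 4 * (nr (K u) * nr v).
  by apply: le_trans (proj_rip_le _ _) _; rewrite mulrCA ler_wpM2l ?nr_ge0.
have h2 : rip (E (Sm (Sm u))) (K v) <= 4 * (nr (K v) * nr u).
  apply: le_trans (proj_rip_le _ _) _; rewrite mulrC mulrCA ler_wpM2l ?nr_ge0//.
have h3 (T : H -> H) : (forall x, nr (T x) <= 2 * nr x) ->
    rip (E (T (D u))) (T (D v)) <= 4 * (nr (D u) * nr (D v)).
  move=> hT; apply: le_trans (proj_rip_le _ _) _.
  apply: le_trans (ler_pM (nr_ge0 _) (nr_ge0 _) (hT _) (hT _)) _.
  by rewrite mulrACA -natrM.
have h3p := h3 (fun x => Sp x) nr_Sp; have h3m := h3 (fun x => Sm x) nr_Sm.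
have k1 := mul_le_weighted (nr (K u)) (nr v) m0.
have k2 := mul_le_weighted (nr (K v)) (nr u) m0.
have k3 := nsq_diff_energy u m0; have k4 := nsq_diff_energy v m0.
have k5 := sqr_ge0 (nr (D u) - nr (D v)).
move: k1 k2 k3 k4 h1 h2 h3p h3m k5; rewrite /energy -!nr_sqr.
move: (m * nr (K u) ^+ 2) (m * nr (K v) ^+ 2) (m^-1 * _ ^+ 2) (m^-1 * _ ^+ 2).
by move=> a1 a2 a3 a4; lra.
Qed.

(** When E fixes the four vectors it can be replaced with the identity, and the form
    becomes 2 |D w|^2 + 2 |D S w|^2. *)
Lemma two_atom_op_fixed w : E (K w) = K w -> E (Sm (Sm w)) = Sm (Sm w) ->
  E (Sp (D w)) = Sp (D w) -> E (Sm (D w)) = Sm (D w) ->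
  rip (two_atom_op E w) w = 2 * (nsq w - nsq (c w)).
Proof.
move=> e1 e2 e3 e4.
have h := two_atom_op_form w w; rewrite e1 e2 e3 e4 in h.
suff : 2 * rip (two_atom_op E w) w = 2 * (2 * (nsq w - nsq (c w))) by lra.
rewrite {}h.
have E1 : rip (K w) w = nsq (D w) by rewrite (rip_sa _ _ diff_sa).
have E2 : rip (K w) (c w) = nsq (D (S w)).
  by rewrite -(rip_sa _ _ sum_sa) !sum_diff (linN lD) opprK (rip_sa _ _ diff_sa).
have E3 : nsq w = nsq (D w) + nsq (D (S w)) + nsq (c w).
  by rewrite (nsq_sum_diff w) (nsq_sum_diff (S w)); ring.
have E4 : nsq (S (D w)) = nsq (D (S w)) by rewrite sum_diff nsqN.
rewrite -!/(nsq _) nsqD nsqB (linD lS) (linB lS) E3 E4.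
move: E1 E2; move: (K w) (S w) => k s E1 E2.
by rewrite !ripE (ripC w k) (ripC s k) (ripC (S s) k) E1 E2; ring.
Qed.

End Form.
Definition sum2_iter n x := iter n (fun y => S (S y)) x.

Lemma sum2_iterS n x : sum2_iter n.+1 x = c (sum2_iter n x). Proof. by []. Qed.
Lemma sum2_iter_linear n : linear (sum2_iter n).
Proof. by elim: n => // n IH k x y; rewrite !sum2_iterS IH !lS. Qed.
Lemma sum2_iter_sa n : selfadjoint (sum2_iter n).
Proof.
move=> x y; elim: n x y => // n IH x y; rewrite sum2_iterS !sum_sa IH.
by congr (inner _ _); rewrite /sum2_iter -iterSr.
Qed.
Lemma sum2_iter_P n x : sum2_iter n (P x) = P (sum2_iter n x).
Proof. by elim: n => // n IH; rewrite !sum2_iterS IH sum2_P. Qed.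
Lemma sum2_iter_Q n x : sum2_iter n (Q x) = Q (sum2_iter n x).
Proof. by elim: n => // n IH; rewrite !sum2_iterS IH sum2_Q. Qed.

(** With b = S ^ 4, this is (1 - b) S ^ (2 n), which is concentrated where D ^ 2
    is of the order of 1 / n. *)
Definition phi n x := sum2_iter n x - sum2_iter n.+2 x.

Lemma phi_linear n : linear (phi n).
Proof.
move=> k x y; rewrite /phi !sum2_iter_linear.
by apply: inner_inj => z; rewrite !(innerDl, innerNl, innerZl); ring.
Qed.
Lemma phi_sa n : selfadjoint (phi n).
Proof. by move=> x y; rewrite /phi innerBl innerBr !sum2_iter_sa. Qed.
Lemma phi_P n x : phi n (P x) = P (phi n x).
Proof. by rewrite /phi !sum2_iter_P (linB lP). Qed.
Lemma phi_Q n x : phi n (Q x) = Q (phi n x).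
Proof. by rewrite /phi !sum2_iter_Q (linB lQ). Qed.
Lemma phiS n x : phi n.+1 x = c (phi n x).
Proof. by rewrite /phi !sum2_iterS (linB lS) (linB lS). Qed.

(** S is selfadjoint, so these are the moments of the spectral measure of S ^ 4 at x, and
    taking differences inserts factors 1 - S ^ 4. *)
Definition moment x n := nsq (sum2_iter n x).

Lemma rip_sum4 z : rip z (c (c z)) = nsq (c z).
Proof. by rewrite /nsq -(rip_sa z _ sum_sa) -(rip_sa (S z) _ sum_sa). Qed.

Lemma nsq_phi n x : nsq (phi n x) = fdiff (fdiff (moment x)) n.
Proof. by rewrite /phi nsqB !sum2_iterS rip_sum4 /fdiff /moment !sum2_iterS; ring. Qed.

(** D ^ 2 = 1 - S ^ 2 is smaller than 1 - S ^ 4. *)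
Lemma nsq_diff2_phi n x : nsq (K (phi n x)) <= fdiff (fdiff (fdiff (fdiff (moment x)))) n.
Proof.
have -> : fdiff (fdiff (fdiff (fdiff (moment x)))) n =
    nsq (phi n x - c (c (phi n x))).
  rewrite nsqB rip_sum4 -!phiS !nsq_phi; rewrite {1 2}/fdiff; ring.
set w := phi n x.
have -> : w - c (c w) = K w + c (K w).
  by rewrite !diff2 !(linB lS); apply: rip_inj => z; rewrite !ripE; ring.
rewrite nsqD -addrA lerDl addr_ge0 ?nsq_ge0// mulr_ge0//.
by rewrite -(rip_sa _ _ sum_sa) nsq_ge0.
Qed.

Lemma moment_ge0 x n : 0 <= moment x n. Proof. exact: nsq_ge0. Qed.
Lemma nr_sum2 x : nr (c x) <= nr x.
Proof. exact: le_trans (nr_sum _) (nr_sum _). Qed.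
Lemma fdiff_moment_ge0 x n : 0 <= fdiff (moment x) n.
Proof. by rewrite subr_ge0 /moment -nr_ler sum2_iterS nr_sum2. Qed.
Lemma fdiff2_moment_ge0 x n : 0 <= fdiff (fdiff (moment x)) n.
Proof. by rewrite -nsq_phi nsq_ge0. Qed.
Lemma fdiff3_moment_ge0 x n : 0 <= fdiff (fdiff (fdiff (moment x))) n.
Proof. by rewrite subr_ge0 -!nsq_phi -nr_ler phiS nr_sum2. Qed.

Lemma moment_decr x n m : (n <= m)%N -> moment x m <= moment x n.
Proof.
elim: m => [|m IH]; first by rewrite leqn0 => /eqP->.
rewrite leq_eqVlt => /predU1P[->//|]; rewrite ltnS => /IH; apply: le_trans.
by rewrite -subr_ge0; exact: fdiff_moment_ge0.
Qed.

Lemma sum2_iter_rip n m x :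
  rip (sum2_iter (n + n) x) (sum2_iter (m + m) x) = moment x (n + m)%N.
Proof.
rewrite /moment /nsq.
have e (i j : nat) : sum2_iter (i + j) x = sum2_iter i (sum2_iter j x) by rewrite /sum2_iter iterD.
rewrite (e n n) (e m m) (rip_sa _ _ (sum2_iter_sa n)).
have -> : sum2_iter n (sum2_iter m (sum2_iter m x)) = sum2_iter m (sum2_iter (n + m) x).
  by rewrite -!e addnCA addnA.
by rewrite -(rip_sa _ _ (sum2_iter_sa m)) -e addnC.
Qed.

(** Only even powers: then the inner product of two iterates is a moment. *)
Lemma nsq_sum2_iter_sub n m x : (n <= m)%N ->
  nsq (sum2_iter (n + n) x - sum2_iter (m + m) x) <= moment x (n + n)%N - moment x (m + m)%N.
Proof.
move=> nm; rewrite nsqB sum2_iter_rip -!/(moment x _).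
have : moment x (m + m)%N <= moment x (n + m)%N by apply: moment_decr; rewrite leq_add2r.
by lra.
Qed.

(** The moments decrease, so the iterates of S ^ 4 at x form a Cauchy sequence.  Its limit
    l satisfies S ^ 4 l = l, hence |S l| = |l| and D l = 0. *)
Lemma moment_cvg0 x (e : R) : (forall z, D z = 0 -> z = 0) -> 0 < e ->
  exists M, moment x M < e.
Proof.
move=> Dinj e0; pose V := [set moment x n | n in [set: nat]].
have V0 : has_inf V.
  by split; [exists (moment x 0), 0%N|exists 0 => _ [n _ <-]; exact: moment_ge0].
have hV n : inf V <= moment x n by apply: ge_inf; [case: V0|exists n].
have adh (d : R) : 0 < d -> exists N, forall n, (N <= n)%N -> moment x n < inf V + d.
  move=> d0; have [_ [N _ <-] hN] := inf_adherent d0 V0; exists N => n Nn.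
  exact: le_lt_trans (moment_decr x Nn) hN.
pose z n := sum2_iter (n + n) x.
have [|l zl] := @hcauchy _ _ z.
  move=> d d0; have [N hN] := adh _ (exprn_gt0 2 d0).
  have h n m : (N <= n)%N -> (n <= m)%N -> nr (z n - z m) < d.
    move=> Nn nm; rewrite -(@ltr_pXn2r _ 2) ?nnegrE ?nr_ge0 ?(ltW d0)// nr_sqr.
    apply: le_lt_trans (nsq_sum2_iter_sub x nm) _.
    have := hN (n + n)%N (leq_trans Nn (leq_addr _ _)); have := hV (m + m)%N; lra.
  exists N => n m Nn Nm; have [nm|mn] := leqP n m; first exact: h.
  by rewrite nrBC h// ltnW.
have ccl : c (c l) = l.
  apply/eqP; rewrite -subr_eq0; apply/eqP/nr_eq0/eqP; rewrite eq_le nr_ge0 andbT.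
  apply/ler_addgt0Pr => d d0; rewrite add0r.
  have [N hN] := zl _ (divr_gt0 d0 (ltr0Sn _ 1)).
  have h1 := hN N (leqnn N); have h2 := hN N.+1 (leqnSn N).
  have zS : z N.+1 = c (c (z N)) by rewrite /z addSn addnS.
  rewrite -(subrKA (z N.+1)); apply: le_trans (nr_triangle _ _) _.
  rewrite (splitr d) lerD ?(ltW h2)// zS -!(linB lS).
  by apply: le_trans (nr_sum2 _) _; apply: le_trans (nr_sum2 _) _; rewrite nrBC ltW.
have l0 : l = 0.
  apply: Dinj; apply: nsq_eq0; apply/eqP; rewrite eq_le nsq_ge0 andbT.
  have h1 := nsq_sum_diff l.
  have h2 : nsq l <= nsq (S l).
    by rewrite -nr_ler -{1}ccl; apply: le_trans (nr_sum2 _) (nr_sum _).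
  by lra.
have se0 : 0 < Num.sqrt e by rewrite sqrtr_gt0.
have [N hN] := zl _ se0.
exists (N + N)%N; rewrite /moment -nr_sqr -(sqr_sqrtr (ltW e0)).
rewrite ltr_pXn2r ?nnegrE ?nr_ge0 ?sqrtr_ge0//.
by have := hN N (leqnn N); rewrite l0 subr0.
Qed.

(** The series sums to 2 |x|^2, and its remainder at 3 M is at most 20 times the moment
    of order M. *)
Lemma moment_sum_ge x : (forall z, D z = 0 -> z = 0) ->
  exists N, nsq x <=
    \sum_(n < N) (n.+1%:R * n.+2%:R) * fdiff (fdiff (fdiff (moment x))) n.
Proof.
move=> Dinj; have [x0|x0] := eqVneq (nsq x) 0.
  by exists 0%N; rewrite big_ord0 x0.
have px : 0 < nsq x / 20 by rewrite divr_gt0// lt_neqAle eq_sym x0 nsq_ge0.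
have [M hM] := moment_cvg0 x Dinj px; exists (M + M + M)%N; rewrite sum_fdiff3.
set f := moment x.
have f0 n : 0 <= f n := moment_ge0 x n.
have f1 n : 0 <= fdiff f n := fdiff_moment_ge0 x n.
have f2 n : 0 <= fdiff (fdiff f) n := fdiff2_moment_ge0 x n.
have f3 n : 0 <= fdiff (fdiff (fdiff f)) n := fdiff3_moment_ge0 x n.
have k1 := fdiff_decay f0 f2 M M.
have k2 := fdiff_decay f1 f3 (M + M) M.
have d1 : fdiff f (M + M + M) <= fdiff f (M + M).
  have := @fdiff_decay _ (fdiff f) f1 f3.
  elim: {k1 k2 hM} M (M + M)%N => [|m IH] k h; first by rewrite addn0.
  rewrite addnS; apply: le_trans (IH k h); rewrite -subr_ge0; exact: f2.
have d0 : f (M + M + M)%N <= f M by apply: moment_decr; rewrite -addnA leq_addr.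
set mm := M%:R : R in k1 k2; have mm0 : 0 <= mm by [].
have mm1 : mm <= mm ^+ 2.
  rewrite /mm -natrX ler_nat; case: {+}M => // m; rewrite expnS expn1 leq_pmulr//.
have -> : (M + M + M)%N%:R = 3 * mm :> R by rewrite !natrD /mm; ring.
have k3 : mm * fdiff f (M + M + M) <= mm * fdiff f (M + M) by rewrite ler_wpM2l.
have k4 : mm * (mm * fdiff (fdiff f) (M + M + M)) <= mm * fdiff f (M + M) by rewrite ler_wpM2l.
have k5 : mm * fdiff (fdiff f) (M + M + M) <= mm ^+ 2 * fdiff (fdiff f) (M + M + M).
  by rewrite ler_wpM2r.
have -> : f 0%N = nsq x by [].
rewrite -/f in hM; lra.
Qed.

Definition localized_op E n u := phi n (two_atom_op E (phi n u)).

(** The weight m = n + 2 in [energy] turns (n+1)(n+2) m and (n+1)(n+2) / m into at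
    most the coefficients of the binomial series of orders 4 and 2. *)
Lemma localized_op_bound E n u v : ortho_proj E ->
  (n.+1%:R * n.+2%:R) * (2 * rip (localized_op E n u) v) <=
  4 * ((n.+1%:R * n.+2%:R * n.+3%:R) * fdiff (fdiff (fdiff (fdiff (moment u)))) n +
       n.+1%:R * fdiff (fdiff (moment u)) n) +
  4 * ((n.+1%:R * n.+2%:R * n.+3%:R) * fdiff (fdiff (fdiff (fdiff (moment v)))) n +
       n.+1%:R * fdiff (fdiff (moment v)) n).
Proof.
move=> pE; rewrite /localized_op (rip_sa _ _ (phi_sa n)).
have m0 : 0 < n.+2%:R :> R by [].
have := two_atom_op_bound pE (phi n u) (phi n v) m0.
have h x : n.+1%:R * n.+2%:R * energy n.+2%:R (phi n x) <=
    (n.+1%:R * n.+2%:R * n.+3%:R) * fdiff (fdiff (fdiff (fdiff (moment x)))) n +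
       n.+1%:R * fdiff (fdiff (moment x)) n.
  rewrite /energy mulrDr lerD//.
    rewrite mulrA ler_pM ?mulr_ge0 ?nsq_ge0 ?nsq_diff2_phi//.
    by rewrite ler_wpM2l ?mulr_ge0// ler_nat.
  by rewrite mulrA mulfK ?gt_eqF// nsq_phi.
have hu := h u; have hv := h v => hb.
have al0 : 0 <= n.+1%:R * n.+2%:R :> R by rewrite mulr_ge0.
apply: le_trans (ler_wpM2l al0 hb) _.
by rewrite mulrCA -[leRHS]mulrDr ler_wpM2l// mulrDr lerD.
Qed.

Lemma sum_localized_bounds N u :
  \sum_(n < N) ((n.+1%:R * n.+2%:R * n.+3%:R) * fdiff (fdiff (fdiff (fdiff (moment u)))) n +
       n.+1%:R * fdiff (fdiff (moment u)) n) <= 7 * nsq u.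
Proof.
rewrite big_split/= sum_fdiff2 sum_fdiff4.
have N0 : 0 <= N%:R :> R by [].
have f0 := moment_ge0 u N; have f1 := mulr_ge0 N0 (fdiff_moment_ge0 u N).
have N1 : 0 <= N%:R * (N%:R + 1) :> R by rewrite mulr_ge0 ?addr_ge0.
have N2 : 0 <= N%:R * (N%:R + 1) * (N%:R + 2) :> R by rewrite mulr_ge0 ?addr_ge0.
have f2 := mulr_ge0 N1 (fdiff2_moment_ge0 u N).
have f3 := mulr_ge0 N2 (fdiff3_moment_ge0 u N).
have -> : moment u 0 = nsq u by [].
lra.
Qed.

Lemma localized_op_fixed E n x : ortho_proj E -> (let w := phi n x in
  [/\ E (K w) = K w, E (Sm (Sm w)) = Sm (Sm w),
  E (Sp (D w)) = Sp (D w) & E (Sm (D w)) = Sm (D w)]) ->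
  rip (localized_op E n x) x = 2 * fdiff (fdiff (fdiff (moment x))) n.
Proof.
move=> pE [e1 e2 e3 e4]; rewrite /localized_op (rip_sa _ _ (phi_sa n)).
by rewrite (two_atom_op_fixed pE e1 e2 e3 e4) -phiS !nsq_phi.
Qed.

End TwoProjections.

(** * Lattices with two atoms *)

Section TwoAtoms.
Context {R : realType} {H : hilbertType R}.
Variable L : subspace_lattice H.
Local Notation A := (compact_Alg L).
Implicit Types (a b : A) (x y u v w : H) (M N S : set H).

(** X E Y is a sum of rank-one operators. *)
Lemma finite_rank_in (E X Y Y' : H -> H) (ws : seq H) :
  (forall u, E u = \sum_(w <- ws) inner u w *: w) -> linear X ->
  (forall u w, inner (Y u) w = inner u (Y' w)) ->
  (forall w, exists a, a = rank_one (X w) (Y' w) :> (H -> H)) ->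
  exists a, forall u, a u = X (E (Y u)).
Proof.
move=> hE lX YY' h.
suff [a ha] : exists a, forall u, a u = X (\sum_(w <- ws) inner (Y u) w *: w).
  by exists a => u; rewrite hE ha.
elim: ws {hE} => [|w ws [a IH]].
  by exists 0 => u; rewrite big_nil (lin0 lX) cA_0E.
have [b hb] := h w; exists (b + a) => u.
by rewrite big_cons (linD lX) cA_addE hb IH (linZ lX) /rank_one YY'.
Qed.

Lemma sandwich_in (E f P Q T : H -> H) (ws : seq H) :
  (forall u, E u = \sum_(w <- ws) inner u w *: w) ->
  linear f -> selfadjoint f -> ortho_proj P -> ortho_proj Q ->
  linear T -> selfadjoint T ->
  (forall x, f (P x) = P (f x)) -> (forall x, f (Q x) = Q (f x)) ->
  (forall w w', exists a, a = rank_one (P w) (w' - Q w') :> (H -> H)) ->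
  exists a, forall u, a u = f (P (T (E (T (f u - Q (f u)))))).
Proof.
move=> hE lf sf [lP _ _] [lQ sQ _] lT sT fP fQ h.
apply: (@finite_rank_in E (fun w => f (P (T w))) (fun u => T (f u - Q (f u)))
  (fun w => f (T w) - Q (f (T w))) ws hE).
- by move=> k x y; rewrite lT lP lf.
- by move=> u w; rewrite sT innerBl innerBr sQ !sf fQ.
- by move=> w; rewrite fP; exact: h.
Qed.

Variables M N : set H.
Hypotheses (LE : sl_mem L = [set [set 0]; M; N; setT]) (MN0 : M `&` N = [set 0])
  (MNT : closed_span (M `|` N) = setT).

Let LM : L M. Proof. by rewrite LE; left; left; right. Qed.
Let LN : L N. Proof. by rewrite LE; left; right. Qed.
Let P := proj M.
Let Q := proj N.
Let pP : ortho_proj P := ortho_proj_proj (sl_closed LM).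
Let pQ : ortho_proj Q := ortho_proj_proj (sl_closed LN).
Let D x := P x - Q x.
Let S x := P x + Q x - x.

Lemma rank_one_MN w w' : exists a, a = rank_one (P w) (w' - Q w') :> (H -> H).
Proof.
apply: rank_one_in => T; rewrite {1}LE => -[[[->|->]|->]|->].
- by right=> s ->; rewrite inner0l.
- by left; exact: (proj_in (sl_closed LM)).
- by right=> s Ns; rewrite innerC (proj_orth (sl_closed LN)) ?rmorph0.
- by left.
Qed.

Lemma rank_one_NM w w' : exists a, a = rank_one (Q w) (w' - P w') :> (H -> H).
Proof.
apply: rank_one_in => T; rewrite {1}LE => -[[[->|->]|->]|->].
- by right=> s ->; rewrite inner0l.
- by right=> s Ms; rewrite innerC (proj_orth (sl_closed LM)) ?rmorph0.
- by left; exact: (proj_in (sl_closed LN)).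
- by left.
Qed.

(** If P z = Q z, this vector is in the intersection of M and N, so it is 0, and z is
    orthogonal to M and N. *)
Lemma diff_injective z : D z = 0 -> z = 0.
Proof.
move/eqP; rewrite subr_eq0 => /eqP PQ.
have cM := sl_closed LM; have cN := sl_closed LN.
have Pz : P z = 0.
  suff : (M `&` N) (P z) by rewrite MN0.
  by split; [exact: proj_in|rewrite PQ; exact: proj_in].
have Qz : Q z = 0 by rewrite -PQ.
have orth : linear_span (M `|` N) `<=` [set y | inner y z = 0].
  apply: linear_span_sub => [|k x y /= hx hy|y [My|Ny]] /=.
  - exact: inner0l.
  - by rewrite innerDl innerZl hx hy mulr0 addr0.
  - by rewrite -(proj_id cM My) (proj_sa cM) -/P Pz inner0r.
  - by rewrite -(proj_id cN Ny) (proj_sa cN) -/Q Qz inner0r.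
have : closed_span (M `|` N) z by rewrite MNT.
move=> /closureP hz; apply: nr_eq0; apply/eqP; rewrite eq_le nr_ge0 andbT.
apply/ler_addgt0Pr => e e0; rewrite add0r; have [y /orth /= yz zy] := hz e e0.
have h : nr z ^+ 2 <= e * nr z.
  rewrite nr_sqr; have -> : nsq z = rip (z - y) z.
    by rewrite ripDl ripNl [rip y z]/rip yz oppr0 addr0.
  by apply: le_trans (rip_le _ _) _; rewrite ler_wpM2r ?nr_ge0// ltW.
have [->|z0] := eqVneq (nr z) 0; first exact: ltW.
by move: h; rewrite expr2 ler_pM2r// lt_neqAle eq_sym z0 nr_ge0.
Qed.

Let DE x : D x = P x - Q x. Proof. by []. Qed.
Let SE x : S x = P x + Q x - x. Proof. by []. Qed.

Lemma localized_op_in (E : H -> H) (ws : seq H) n :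
  (forall u, E u = \sum_(w <- ws) inner u w *: w) -> 
  exists a, forall u, a u = localized_op P Q S E n u.
Proof.
move=> hE.
have lS := sum_linear pP pQ SE; have sS := sum_sa pP pQ SE.
have lf := phi_linear pP pQ SE n; have sf := phi_sa pP pQ SE n.
have fP := phi_P pP pQ SE n; have fQ := phi_Q pP pQ SE n.
have lp : linear (fun x => x + S x).
  move=> k x y; rewrite (lS k x y); move: (S x) (S y) => s t.
  by apply: inner_inj => z; rewrite !(innerDl, innerNl, innerZl); ring.
have lm : linear (fun x => x - S x).
  move=> k x y; rewrite (lS k x y); move: (S x) (S y) => s t.
  by apply: inner_inj => z; rewrite !(innerDl, innerNl, innerZl); ring.
have sp : selfadjoint (fun x => x + S x).
  by move=> x y; rewrite innerDl (innerDr y (S y)) sS.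
have sm : selfadjoint (fun x => x - S x).
  by move=> x y; rewrite innerBl (innerBr y (S y)) sS.
have [a1 h1] := sandwich_in hE lf sf pP pQ lp sp fP fQ rank_one_MN.
have [a2 h2] := sandwich_in hE lf sf pP pQ lm sm fP fQ rank_one_MN.
have [a3 h3] := sandwich_in hE lf sf pQ pP lp sp fQ fP rank_one_NM.
have [a4 h4] := sandwich_in hE lf sf pQ pP lm sm fQ fP rank_one_NM.
exists ((a1 + a2) + (a3 + a4)) => u; rewrite !cA_addE h1 h2 h3 h4.
have [lP _ _] := pP; have [lQ _ _] := pQ.
by rewrite -!(linD lf) -(linD lP) -(linD lQ).
Qed.

(** The sum of the (n+1)(n+2) [localized_op] E_n n, where E_n fixes the four vectors
    that occur at x in the n-th term. *)
Lemma two_atoms_coercive_unit : coercive_unit L.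
Proof.
(* 28 is 4 times the bound 7 of [sum_localized_bounds], and 2 is the factor in
   [localized_op_fixed]. *)
exists 28, 2; split=> // x.
have /choice[b hb] n : exists b,
    (forall u v, (n.+1%:R * n.+2%:R) * (2 * rip (b u) v) <=
      4 * ((n.+1%:R * n.+2%:R * n.+3%:R) * fdiff (fdiff (fdiff (fdiff (moment S u)))) n +
       n.+1%:R * fdiff (fdiff (moment S u)) n) +
      4 * ((n.+1%:R * n.+2%:R * n.+3%:R) * fdiff (fdiff (fdiff (fdiff (moment S v)))) n +
       n.+1%:R * fdiff (fdiff (moment S v)) n)) /\
    rip (b x) x = 2 * fdiff (fdiff (fdiff (moment S x))) n.
  pose w := phi S n x.
  have [E [ws [pE fE hE]]] := finite_rank_projection
    [:: D (D w); (w - S w) - S (w - S w); D w + S (D w); D w - S (D w)].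
  have [b bE] := localized_op_in n hE; exists b; split.
    by move=> u v; rewrite bE; exact: (localized_op_bound pP pQ DE SE).
  rewrite bE; apply: (localized_op_fixed pP pQ DE SE pE).
  by split; apply: fE; rewrite !inE eqxx ?orbT.
have [K hK] := moment_sum_ge pP pQ DE SE x diff_injective.
have [a ha] : exists a, forall u,
    a u = \sum_(n < K) (n.+1%:R * n.+2%:R)%:C%C *: b n u.
  elim: K {hK} => [|K [a ha]]; first by exists 0 => u; rewrite big_ord0 cA_0E.
  exists (a + (K.+1%:R * K.+2%:R)%:C%C *: b K) => u.
  by rewrite cA_addE cA_scaleE ha big_ord_recr.
have rs u v : rip (a u) v = \sum_(n < K) (n.+1%:R * n.+2%:R) * rip (b n u) v.
  rewrite ha; elim: K {hK ha} => [|K IH]; first by rewrite !big_ord0 rip0l.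
  by rewrite !big_ord_recr/= ripDl ripZl IH.
exists a; split.
  apply: bounded_by_form => // u v; rewrite rs mulr_sumr.
  apply: (@le_trans _ _ (4 * (7 * nsq u) + 4 * (7 * nsq v))); last by lra.
  have tu := sum_localized_bounds pP pQ DE SE K u.
  have tv := sum_localized_bounds pP pQ DE SE K v.
  apply: (le_trans _ (lerD (ler_wpM2l _ tu) (ler_wpM2l _ tv))) => //.
  rewrite !mulr_sumr -big_split/=; apply: ler_sum => n _.
  by rewrite mulrCA; case: (hb n).
rewrite rs; apply: le_trans (ler_wpM2l _ hK) _ => //.
rewrite mulr_sumr; apply: ler_sum => n _.
by have [_ ->] := hb n; rewrite mulrCA.
Qed.

End TwoAtoms.

Theorem corollary1 (R : realType) (H : hilbertType R)
    (separableH : separable H) (L : subspace_lattice H)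
    (hypL : (commutative_lattice L /\ completely_distributive L) \/
            two_atoms L) :
  alg_isomorphic (multiplier (compact_Alg L)) (Alg L).
Proof.
apply: multiplier_compact_Alg_iso; apply: coercive_approx_unit.
case: hypL => [[cL cdL]|[M [N [LE MN0 MNT]]]].
  exact: distributive_coercive_unit.
exact: two_atoms_coercive_unit LE MN0 MNT.
Qed.
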